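(* Let $H$ be a graph and let $v\in V(H)$ be a vertex that is not isolated. Then $H$ is a PCA graph if and only if $H\setminus\{v\}$ admits a round representation $\Phi$ that is $v$-receptive. Furthermore, for such a $\Phi$ and a receptive pair $(B_l,B_r)$ of $\Phi$ witnessing that $\Phi$ is $v$-receptive, the $\{v\}$-reception of $(B_l,B_r)$ in $\Phi$ is a round representation of $H$.
   Context: Orderings. A finite ordering $X=x_1,\dots,x_n$ is either linear or circular. Its right near neighbour map is $R(x_i)=x_{i+1}$ for $1\le i<n$, with $R(x_n)=x_1$ if $X$ is circular and $R(x_n)=\bot$ if linear; the left near neighbour map $L$ is symmetric ($L(x_{i+1})=x_i$, $L(x_1)=x_n$ if circular, $\bot$ if linear). Indices are taken modulo $n$; the range $[x_i,x_j]$ is the linear ordering $x_i,x_{i+1},\dots,x_j$, and $(x_i,x_j]$, $[x_i,x_j)$, $(x_i,x_j)$ are obtained by deleting the leftmost and/or rightmost element. $\bot$ is an undefined value with $f(\bot)=\bot$ for every map $f$ below. Contigs. A contig is a pair $\phi=(\mathcal B(\phi),F_r)$ where $\mathcal B(\phi)=B_1,\dots,B_n$ is a linear or circular ordering of pairwise disjoint nonempty sets (semiblocks) and $F_r:\mathcal B(\phi)\to\mathcal B(\phi)$ satisfies: (i) $F_r(B_i)\in(B_i,F_r(B_{i+1})]$ for $1\le i<n$; (ii) if $\mathcal B(\phi)$ is linear then $F_r(B_n)=B_n$, otherwise $F_r(B_n)\in[B_1,F_r(B_1)]$; (iii) $B_i\notin(F_r(B_i),F_r(F_r(B_i))]$ for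 all $i$. Write $B\to W$ when $W\in(B,F_r(B)]$. The left far neighbour $F_l(B)$ is the unique semiblock with: $W\to B$ iff $W\in[F_l(B),B)$. Round representations. A round representation $\Phi$ is a finite family of contigs with pairwise disjoint vertex sets such that either $|\Phi|=1$ or all its contigs are linear. $\mathcal B(\Phi)$ is the set of all semiblocks of its contigs and $V(\Phi)$ their union; $L,R,F_l,F_r$ act inside the contig containing the semiblock, and $B\to W$ requires $B,W$ to lie in the same contig. $B$ is a left (right) end semiblock if $L(B)=\bot$ ($R(B)=\bot$). The graph $G(\Phi)$ has vertex set $V(\Phi)$, with $x\in B$ and $y\in W$ adjacent iff $B=W$, $B\to W$ or $W\to B$. A graph is PCA if it is isomorphic to $G(\Phi)$ for some round representation $\Phi$; $\Phi$ then represents it. For semiblocks $B_1,B_2$ in different contigs $\phi_1,\phi_2$, the range $[B_1,B_2]$ is the range from $B_1$ to the right end semiblock of $\phi_1$ followed by the range from the left end semiblock of $\phi_2$ to $B_2$. Two semiblocks $B,W$ are indistinguishable if $F_l(B)=F_l(W)$ and $F_r(B)=F_r(W)$. Receptions. Let $\Psi$ be a round representation in which $\{v\}$ is a semiblock, and let $\Phi=\Psi\setminus\{\{v\}\}$ be the round representation obtained by deleting $\{v\}$ from the ordering of its contig (splitting it if necessary) such that $B\to_\Phi W$ iff $B\to_\Psi W$ for all remaining semiblocks. Let $B_l=F_l(\{v\})$ if $\{v\}$ is not a left end semiblock of $\Psi$ and $B_l=R(\{v\})$ otherwise; let $B_r=F_r(\{v\})$ if $\{v\}$ is not a right end semiblock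 and $B_r=L(\{v\})$ otherwise. Then $(B_l,B_r)$ is called a receptive pair of $\Phi$, and $\Psi$ is the $\{v\}$-reception of $(B_l,B_r)$ in $\Phi$. A round representation $\Phi$ of $H\setminus\{v\}$ is $v$-receptive if it has a receptive pair $(B_l,B_r)$ with $N_H(v)=\bigcup[B_l,B_r]$ and such that no two distinct semiblocks of $\mathcal B(\Phi)\setminus\{B_l,B_r\}$ are indistinguishable. *)

(* Defs.v *)
From HB Require Import structures.
From mathcomp Require Import all_boot.

Set Implicit Arguments.
Unset Strict Implicit.
Unset Printing Implicit Defensive.

(* Finite simple graphs; the vertex set is a subset of an ambient finite type,
   so that a graph and its vertex-deleted subgraph share their labels. *)

Record sgraph (T : finType) := SGraph {
  vset : {set T};
  edge : rel T;
  edge_sym : symmetric edge;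
  edge_irr : irreflexive edge;
  edge_vset : forall x y, edge x y -> x \in vset }.

Section Graphs.
Variables T U : finType.

Definition same_graph (G K : sgraph T) : Prop :=
  vset G = vset K /\ edge G =2 edge K.

Definition isomorphic (G : sgraph T) (K : sgraph U) : Prop :=
  exists2 f : {x : T | x \in vset G} -> {y : U | y \in vset K},
    bijective f & forall x y, edge K (val (f x)) (val (f y)) = edge G (val x) (val y).

Definition nbh (G : sgraph T) (x : T) : {set T} := [set y | edge G x y].

Definition remove_edge (G : sgraph T) (v : T) : rel T :=
  fun x y => [&& x != v, y != v & edge G x y].

Lemma remove_edge_sym G v : symmetric (remove_edge G v).
Proof. by move=> x y; rewrite /remove_edge andbCA edge_sym. Qed.

Lemma remove_edge_irr G v : irreflexive (remove_edge G v).
Proof. by move=> x; rewrite /remove_edge edge_irr !andbF. Qed.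

Lemma remove_edge_vset G v x y :
  remove_edge G v x y -> x \in vset G :\ v.
Proof. by case/and3P=> xv _ /edge_vset xG; rewrite !inE xv. Qed.

Definition remove_vertex (G : sgraph T) (v : T) : sgraph T :=
  SGraph (@remove_edge_sym G v) (@remove_edge_irr G v) (@remove_edge_vset G v).

End Graphs.

(* Ranges of an ordering s without repetitions, for x and y in s.  Indices are
   taken modulo the size of s, even when s stands for a linear ordering. *)

Section Ranges.
Variables (A : eqType) (s : seq A).

(* [x, y] *)
Definition range_cc (x y : A) : seq A :=
  let s' := rot (index x s) s in take (index y s').+1 s'.

(* (x, y] *)
Definition range_oc (x y : A) : seq A := behead (range_cc x y).

(* [x, y) *)
Definition range_co (x y : A) : seq A :=
  let r := range_cc x y in take (size r).-1 r.

End Ranges.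

(* The values of far_r outside of blocks are irrelevant. *)
Record contig (T : finType) := Contig {
  circular : bool;
  blocks : seq {set T};
  far_r : {set T} -> {set T};
  blocks_neq_nil : blocks != [::];
  blocks_neq_set0 : set0 \notin blocks;
  blocks_disjoint : pairwise (fun B W : {set T} => [disjoint B & W]) blocks;
  far_r_blocks : {in blocks, forall B, far_r B \in blocks};
  far_r_step : forall i, i.+1 < size blocks ->
    far_r (nth set0 blocks i)
      \in range_oc blocks (nth set0 blocks i) (far_r (nth set0 blocks i.+1));
  far_r_last :
    if circular
    then far_r (last set0 blocks)
           \in range_cc blocks (head set0 blocks) (far_r (head set0 blocks))
    else far_r (last set0 blocks) == last set0 blocks;
  far_r_no_wrap : {in blocks, forall B,
    B \notin range_oc blocks (far_r B) (far_r (far_r B))} }.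

Section Contigs.
Variables (T : finType) (c : contig T).

(* None plays the role of the undefined value. *)
Definition contig_R (B : {set T}) : option {set T} :=
  if (B \in blocks c) && (circular c || (B != last set0 (blocks c)))
  then Some (next (blocks c) B) else None.

Definition contig_L (B : {set T}) : option {set T} :=
  if (B \in blocks c) && (circular c || (B != head set0 (blocks c)))
  then Some (prev (blocks c) B) else None.

Definition contig_arrow (B W : {set T}) : bool :=
  (B \in blocks c) && (W \in range_oc (blocks c) B (far_r c B)).

Definition contig_Fr (B : {set T}) : option {set T} :=
  if B \in blocks c then Some (far_r c B) else None.

Definition contig_Fl (B : {set T}) : option {set T} :=
  if B \in blocks c then
    [pick X in blocks c |
      all (fun W => contig_arrow W B == (W \in range_co (blocks c) X B)) (blocks c)]
  else None.

Definition contig_vset : {set T} := \bigcup_(B <- blocks c) B.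

End Contigs.

Record round_rep (T : finType) := RoundRep {
  contigs : seq (contig T);
  contigs_disjoint :
    pairwise (fun c d => [disjoint contig_vset c & contig_vset d]) contigs;
  contigs_kind :
    (size contigs == 1) || all (fun c => ~~ circular c) contigs }.

Section RoundRepresentations.
Variable T : finType.
Implicit Types (Phi Psi : round_rep T) (B W : {set T}) (v x y : T).

Definition semiblocks Phi : seq {set T} := flatten (map (@blocks T) (contigs Phi)).

Definition rr_vset Phi : {set T} := \bigcup_(B <- semiblocks Phi) B.

Definition contig_of Phi B : option (contig T) :=
  ohead [seq c <- contigs Phi | B \in blocks c].

Definition near_R Phi B := obind (fun c => contig_R c B) (contig_of Phi B).
Definition near_L Phi B := obind (fun c => contig_L c B) (contig_of Phi B).
Definition far_R Phi B := obind (fun c => contig_Fr c B) (contig_of Phi B).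
Definition far_L Phi B := obind (fun c => contig_Fl c B) (contig_of Phi B).

Definition arrow Phi B W : bool := has (fun c => contig_arrow c B W) (contigs Phi).

Definition left_end Phi B : bool := near_L Phi B == None.
Definition right_end Phi B : bool := near_R Phi B == None.

Definition rr_edge Phi : rel T := fun x y =>
  (x != y) &&
  has (fun B => has (fun W =>
         [&& x \in B, y \in W & [|| B == W, arrow Phi B W | arrow Phi W B]])
       (semiblocks Phi)) (semiblocks Phi).

Lemma rr_edge_sym Phi : symmetric (rr_edge Phi).
Proof.
suff sub x y : rr_edge Phi x y -> rr_edge Phi y x by move=> x y; apply/idP/idP; exact: sub.
case/andP=> xy /hasP[B B_in /hasP[W W_in /and3P[xB yW adj]]].
rewrite /rr_edge eq_sym xy /=; apply/hasP; exists W => //.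
by apply/hasP; exists B => //; rewrite yW xB eq_sym [arrow _ W B || _]orbC.
Qed.

Lemma rr_edge_irr Phi : irreflexive (rr_edge Phi).
Proof. by move=> x; rewrite /rr_edge eqxx. Qed.

Lemma rr_edge_vset Phi x y : rr_edge Phi x y -> x \in rr_vset Phi.
Proof.
case/andP=> _ /hasP[B B_in /hasP[W _ /and3P[xB _ _]]].
by rewrite /rr_vset (big_rem B) //= inE xB.
Qed.

Definition graph_of Phi : sgraph T :=
  SGraph (@rr_edge_sym Phi) (@rr_edge_irr Phi) (@rr_edge_vset Phi).

(* Labelled: Phi is a round representation of this very graph H. *)
Definition represents Phi (H : sgraph T) : Prop := same_graph (graph_of Phi) H.

(* If B and W lie in different contigs then both contigs are linear. *)
Definition rr_range Phi B W : seq {set T} :=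
  match contig_of Phi B, contig_of Phi W with
  | Some b, Some w =>
      if W \in blocks b then range_cc (blocks b) B W
      else range_cc (blocks b) B (last set0 (blocks b))
           ++ range_cc (blocks w) (head set0 (blocks w)) W
  | _, _ => [::]
  end.

Definition indistinguishable Phi B W : Prop :=
  far_L Phi B = far_L Phi W /\ far_R Phi B = far_R Phi W.

(* Phi is obtained from Psi by deleting the semiblock {v}.  The orderings of the
   contigs are compared through their right near neighbour maps, because the
   contigs of a family are unordered and a circular ordering has no first
   element.  The left near neighbour of {v} either inherits the right near
   neighbour of {v} or, if the contig is split at {v}, becomes a right end; the
   condition on arrows allows a split only when the former has no arrow to the
   latter. *)
Definition deletion Psi v Phi : Prop :=
  [/\ semiblocks Phi =i [predD1 semiblocks Psi & [set v]],
      {in semiblocks Phi, forall B,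
         if near_R Psi B == Some [set v]
         then near_R Phi B = near_R Psi [set v] \/ near_R Phi B = None
         else near_R Phi B = near_R Psi B}
    & {in semiblocks Phi &, arrow Phi =2 arrow Psi}].

(* Psi is the {v}-reception of (Bl, Br) in Phi.  Bl and Br are required to be
   semiblocks of Phi: the contig axioms admit circular contigs in which the last
   semiblock is its own right far neighbour (and the first its own left far
   neighbour), where the formulas below may return {v} itself. *)
Definition reception v Phi Bl Br Psi : Prop :=
  let Bv := [set v] in
  [/\ Bv \in semiblocks Psi,
      deletion Psi v Phi,
      Bl \in semiblocks Phi /\ Br \in semiblocks Phi,
      (if left_end Psi Bv then near_R Psi Bv else far_L Psi Bv) = Some Bl
    & (if right_end Psi Bv then near_L Psi Bv else far_R Psi Bv) = Some Br].

Definition receptive_pair v Phi Bl Br : Prop :=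
  exists Psi, reception v Phi Bl Br Psi.

Definition receptive_by (H : sgraph T) v Phi Bl Br : Prop :=
  [/\ receptive_pair v Phi Bl Br,
      nbh H v = \bigcup_(B <- rr_range Phi Bl Br) B
    & forall B W,
        B \in semiblocks Phi -> B \notin [:: Bl; Br] ->
        W \in semiblocks Phi -> W \notin [:: Bl; Br] ->
        B != W -> ~ indistinguishable Phi B W].

Definition receptive (H : sgraph T) v Phi : Prop :=
  exists Bl Br, receptive_by H v Phi Bl Br.

End RoundRepresentations.

Definition PCA (T : finType) (H : sgraph T) : Prop :=
  exists (U : finType) (Phi : round_rep U), isomorphic H (graph_of Phi).

(* Main.v *)
Require Import Defs.
From mathcomp Require Import all_boot zify.

(** The arrows of a round representation are an asymmetric relation on a
    cyclically ordered set of semiblocks such that [x -> z] implies [x -> y] and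
    [y -> z] whenever [y] lies strictly between [x] and [z].  Conversely every such
    relation, consecutive elements being joined or not, is the arrow relation of
    a round representation: either all consecutive pairs are joined and the
    ordering is a single circular contig, or it can be cut at a gap and falls
    into linear contigs.  The property is inherited by subsets, which makes
    deletions of semiblocks free of case distinctions.

    For a PCA graph [H], blow every semiblock up into its vertices and keep one
    vertex from each class of true twins of [H], [v] being kept alone in its
    class; this yields [Psi], and removing [{v}] yields [Phi].  If two semiblocks
    [X -> Y] other than [Bl] and [Br] are indistinguishable in [Phi], then exactly
    one of them is adjacent to [v], for otherwise they would be twins in [H].  By
    the betweenness property [v] is not between them, so [Bl] (or [Br]) is, and it
    is then a twin in [H] of that one of [X] and [Y] which is adjacent to [v]: a
    contradiction.  In the other direction, [Bl] and [Br] delimit the neighbours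
    of [v] in any reception, wherever the ordering is cut or glued at [{v}]. *)

(** The obstacle in the second direction is that [Phi] is not a constructed object: a deletion fixes
    it only through its arrows and right near neighbours. Its contigs have to be recovered as paths
    of near neighbours, and the range from [Bl] to [Br] must come out the same whether the place of
    [{v}] has been closed up or turned into a gap. In the first direction the given representation
    lives over a foreign vertex type, and in it [v] may share a semiblock with other vertices; its
    arrows are therefore transported to a relation on the vertices of [H] before any semiblock of
    [Psi] is formed. Arrows between twin classes are read off from one representative each, which is
    sound because betweenness passes to subsets. Twins are compared by closed neighbourhoods in [H],
    whereas indistinguishability compares far neighbours in [Phi]; the link is that equal left far
    neighbours already force an arrow between the two semiblocks. *)

Set Implicit Arguments.
Unset Strict Implicit.
Unset Printing Implicit Defensive.

(** * Ranges and the arrows of a contig *)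

(* Positions on a circle: [in_arc i j k] places [j] in the arc [[i, k]], which wraps
   around when [k < i], and [cyc i j k] places it strictly between [i] and [k]. *)
Definition in_arc (i j k : nat) := [|| i <= j <= k, j <= k < i | k < i <= j].
Definition cyc (i j k : nat) := [|| i < j < k, j < k < i | k < i < j].

Section Ranges.
Variables (A : eqType) (s : seq A).
Hypothesis s_uniq : uniq s.

Lemma index_rot k w : k <= size s -> w \in s ->
  index w (rot k s) =
    if k <= index w s then index w s - k else index w s + (size s - k).
Proof.
move=> k_le ws; rewrite /rot index_cat.
have in_t : (w \in take k s) = (index w s < k) by rewrite in_take.
have in_d : (w \in drop k s) = (k <= index w s).
  move: s_uniq ws; rewrite -{1 2}(cat_take_drop k s) cat_uniq mem_cat in_t.
  case/and3P=> _ /hasPn disj _ /orP[lt|wd]; last by rewrite wd leqNgt -in_t disj.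
  by rewrite leqNgt lt; apply/negbTE/negP => /disj /=; rewrite in_t lt.
have eq_i : index w s = if w \in take k s then index w (take k s)
                        else size (take k s) + index w (drop k s).
  by rewrite -{1}(cat_take_drop k s) index_cat.
move: eq_i; rewrite in_d in_t size_drop size_takel //.
clear in_t in_d ws; by case: (leqP k (index w s)) => ?; lia.
Qed.

Lemma mem_range_cc x y w : x \in s -> y \in s -> w \in s ->
  (w \in range_cc s x y) = in_arc (index x s) (index w s) (index y s).
Proof.
move=> xs ys ws; rewrite /range_cc in_take ?mem_rot //.
have := xs; have := ys; have := ws; rewrite -!index_mem => wi yi xi.
rewrite !index_rot ?(ltnW xi) // /in_arc.
by case: (leqP (index x s) (index y s)); case: (leqP (index x s) (index w s)); lia.
Qed.

Lemma range_cc_sub x y : {subset range_cc s x y <= s}.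
Proof. by move=> w /mem_take; rewrite mem_rot. Qed.

Lemma range_ccE x y : x \in s -> range_cc s x y = x :: range_oc s x y.
Proof. by move=> xs; rewrite /range_oc /range_cc rot_index. Qed.

Lemma range_cc_uniq x y : uniq (range_cc s x y).
Proof. by rewrite take_uniq ?rot_uniq. Qed.

Lemma mem_range_oc x y w : x \in s ->
  (w \in range_oc s x y) = (w != x) && (w \in range_cc s x y).
Proof.
move=> xs; have := range_cc_uniq x y; rewrite range_ccE // inE /= => /andP[xN _].
by have [->|] := eqVneq w x => //=; rewrite (negPf xN).
Qed.

Lemma range_ccEr x y : y \in s -> range_cc s x y = rcons (range_co s x y) y.
Proof.
move=> ys; rewrite /range_co /range_cc; set s' := rot _ _.
have lt : index y s' < size s' by rewrite index_mem mem_rot.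
rewrite size_takel //= take_takel // [RHS](_ : _ = rcons (take (index y s') s') (nth y s' (index y s'))).
  by rewrite -take_nth.
by rewrite nth_index // mem_rot.
Qed.

Lemma mem_range_co x y w : y \in s ->
  (w \in range_co s x y) = (w != y) && (w \in range_cc s x y).
Proof.
move=> ys; have := range_cc_uniq x y.
rewrite range_ccEr // rcons_uniq mem_rcons inE => /andP[yN _].
by have [->|] := eqVneq w y => //=; rewrite (negPf yN).
Qed.

Lemma range_cc_rot k x y : k <= size s -> x \in s ->
  range_cc (rot k s) x y = range_cc s x y.
Proof.
move=> k_le xs; rewrite /range_cc.
suff -> : rot (index x (rot k s)) (rot k s) = rot (index x s) s by [].
have := xs; rewrite -index_mem => xlt.
rewrite index_rot //; case: leqP => H; rewrite rot_add_mod //; try lia.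
  by case: ifP => H'; congr rot; lia.
case: ifP => H'; last by congr rot; lia.
have -> : index x s = 0 by lia.
by rewrite add0n subnK // rot_size rot0.
Qed.

End Ranges.

(** Positions are a parameter instead of indices in [s], so that a sublist keeps the positions of
    the whole and inherits the property at once. Only the cyclic order of the positions matters. *)
Definition round_on (A : eqType) (s : seq A) (pos : A -> nat) (r : rel A) :=
  {in s &, forall x y, r x y -> ~~ r y x} /\
  {in s & &, forall x y z, cyc (pos x) (pos y) (pos z) -> r x z -> r x y && r y z}.

Lemma disjoint_uniq (T : finType) (s : seq {set T}) : set0 \notin s ->
  pairwise (fun B W : {set T} => [disjoint B & W]) s -> uniq s.
Proof.
elim: s => //= B s IH; rewrite inE negb_or => /andP[B0 s0] /andP[/allP Bs /IH->//].
rewrite andbT; apply/negP => /Bs; rewrite -setI_eq0 setIid => /eqP E.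
by rewrite E eqxx in B0.
Qed.

Section ContigRound.
Variables (T : finType) (c : contig T).
Let s := blocks c.
Implicit Types B W U : {set T}.

Lemma blocks_uniq : uniq (blocks c).
Proof. exact: disjoint_uniq (blocks_neq_set0 c) (blocks_disjoint c). Qed.
Let us : uniq s := blocks_uniq.

Lemma index_blocks B : B \in s -> index B s < size s.
Proof. by rewrite -index_mem. Qed.

Lemma arrow_blocks B W : contig_arrow c B W -> (B \in s) && (W \in s).
Proof.
case/andP=> Bs; rewrite Bs /= mem_range_oc ?blocks_uniq // => /andP[_].
by apply: range_cc_sub.
Qed.

Lemma contig_arrowE B W (f := index (far_r c B) s) : B \in s -> W \in s ->
  contig_arrow c B W = (index W s != index B s) && in_arc (index B s) (index W s) f.
Proof.
move=> Bs Ws; rewrite /contig_arrow Bs /= mem_range_oc // mem_range_cc //.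
  by rewrite (inj_in_eq (@index_inj _ set0 s)).
exact: far_r_blocks.
Qed.

Lemma far_step i (f := fun i => index (far_r c (nth set0 s i)) s) : i.+1 < size s ->
  (f i != i) && in_arc i (f i) (f i.+1).
Proof.
move=> lt; have := far_r_step lt; rewrite -/s.
have m j : j < size s -> nth set0 s j \in s by exact: mem_nth.
rewrite mem_range_oc ?m ?(ltnW lt) // mem_range_cc ?far_r_blocks ?m ?(ltnW lt) //.
have -> : index (nth set0 s i) s = i by rewrite index_uniq // ltnW.
suff -> : (far_r c (nth set0 s i) != nth set0 s i) = (f i != i) by [].
rewrite -(inj_in_eq (@index_inj _ set0 s)) ?far_r_blocks ?m ?(ltnW lt) //.
by rewrite [index (nth _ _ _) s]index_uniq // ltnW.
Qed.

Lemma size_blocks : 0 < size s.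
Proof. by rewrite lt0n size_eq0 blocks_neq_nil. Qed.

Lemma far_last (f := fun i => index (far_r c (nth set0 s i)) s) :
  if circular c then f (size s).-1 <= f 0 else f (size s).-1 == (size s).-1.
Proof.
have := far_r_last c; rewrite -nth_last -nth0 -/s.
have m j : j < size s -> nth set0 s j \in s by exact: mem_nth.
have s0 := size_blocks.
have l1 : (size s).-1 < size s by rewrite prednK.
case: ifP => _.
  rewrite mem_range_cc ?far_r_blocks ?m // [index (nth set0 s 0) s]index_uniq //=.
  by rewrite /in_arc /f; lia.
by move/eqP; rewrite /f => ->; rewrite index_uniq.
Qed.

(** If [W] lies in the range from [B] to its far neighbour and is not the cyclic successor of [B],
    it lies beyond that successor, whose far neighbour reaches at least as far. At the last
    semiblock a circular contig continues at position 0, and in a linear one there is no arrow to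
    treat. *)
Lemma arrow_step B W (j := if (index B s).+1 < size s then (index B s).+1 else 0) :
  contig_arrow c B W -> index W s != j -> contig_arrow c (nth set0 s j) W.
Proof.
move=> BW; have /andP[Bs Ws] := arrow_blocks BW.
have s0 := size_blocks; have Bi := index_blocks Bs; have Wi := index_blocks Ws.
have jlt : j < size s by rewrite /j; case: ifP.
move: BW; rewrite contig_arrowE // contig_arrowE ?mem_nth // [index (nth _ _ _) s]index_uniq //.
have := nth_index set0 Bs; move: (index B s) (index W s) Bi Wi @j jlt => b w Bi Wi j jlt <-.
rewrite /in_arc /j {jlt j}; case: (ltnP b.+1 (size s)) => [lt|ge]; first by have := far_step lt; rewrite /in_arc /=; lia.
have -> : b = (size s).-1 by lia.
by have := far_last; case: circular => /=; lia.
Qed.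

(** The arrow [x -> y] is immediate, since the targets of [x] fill a range from [x]; [y -> z]
    follows by walking from [x] to [y] with [arrow_step]. For asymmetry, if [x -> y -> x] then the
    far neighbour of [x] is [y] or lies strictly between [y] and [x], so it has an arrow to [x],
    which [far_r_no_wrap] forbids. *)
Lemma contig_round : round_on s (index^~ s) (contig_arrow c).
Proof.
have between : {in s & &, forall x y z, cyc (index x s) (index y s) (index z s) ->
    contig_arrow c x z -> contig_arrow c x y && contig_arrow c y z}.
  move=> x y z xs ys zs cy xz; apply/andP; split.
    by move: xz; rewrite !contig_arrowE //; move: cy; rewrite /in_arc /cyc; lia.
  have zi := index_blocks zs; have yi := index_blocks ys; have xi := index_blocks xs.
  (* [m] is the number of steps from [x] to position [j]; the disjunction is the equation modulo the
     size. *)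
  have walk m j : j < size s -> j = index x s + m \/ j + size s = index x s + m ->
      j = index x s \/ cyc (index x s) j (index z s) -> contig_arrow c (nth set0 s j) z.
    elim: m j => [|m IH] j jlt jE; first by move=> _; rewrite (_ : j = index x s) ?nth_index //; lia.
    case=> [->|cyj]; first by rewrite nth_index.
    pose j' := if j is k.+1 then k else (size s).-1.
    have [j'lt [j'E cyj']] : j' < size s /\
        (j' = index x s + m \/ j' + size s = index x s + m) /\
        (j' = index x s \/ cyc (index x s) j' (index z s)).
      by rewrite /j' /cyc; move: cyj; rewrite /cyc; case: j jE jlt {j'} => [|k]; lia.
    have := arrow_step (IH _ j'lt j'E cyj'); rewrite index_uniq //.
    have -> : (if j'.+1 < size s then j'.+1 else 0) = j.
      by rewrite /j'; case: (j) jlt => [_|k ->] //; rewrite prednK ?ltnn ?size_blocks.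
    by apply; move: cyj; rewrite /cyc; lia.
  rewrite -(nth_index set0 ys).
  apply: (walk (if index x s <= index y s then index y s - index x s
                else index y s + size s - index x s)) => //; last by right.
  by case: leqP; lia.
split=> // x y xs ys xy; apply/negP => yx.
have fs := @far_r_blocks _ c x xs.
have /negP[] := @far_r_no_wrap _ c x xs.
suff /andP[] : contig_arrow c (far_r c x) x by [].
have [<-//|ne] := eqVneq y (far_r c x).
have ne' : index y s != index (far_r c x) s by rewrite (inj_in_eq (@index_inj _ set0 s)).
have cy : cyc (index y s) (index (far_r c x) s) (index x s).
  by move: xy yx; rewrite !contig_arrowE // /in_arc /cyc; lia.
by case/andP: (between _ _ _ ys fs xs cy yx).
Qed.

(** Far neighbours in a linear contig never wrap around: the last semiblock is its own, and going
    downwards, the far neighbour of position [i] lies on the arc from [i] to that of [i + 1], which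
    does not pass the end. *)
Lemma linear_arrow B W : ~~ circular c -> contig_arrow c B W -> index B s < index W s.
Proof.
move=> lin BW; have /andP[Bs Ws] := arrow_blocks BW.
have far_ge m : m < size s ->
    (size s).-1 - m <= index (far_r c (nth set0 s ((size s).-1 - m))) s.
  have := far_last; rewrite (negPf lin) => /eqP fl.
  elim: m => [_|m IH lt]; first by rewrite subn0 fl.
  have {}IH := IH (ltnW lt); have := @far_step ((size s).-1 - m.+1).
  have -> : ((size s).-1 - m.+1).+1 = (size s).-1 - m by lia.
  by move/(_ ltac:(lia)); rewrite /in_arc /=; lia.
have Bi := index_blocks Bs; move: (far_ge ((size s).-1 - index B s) ltac:(lia)).
rewrite subKn; last by lia.
by rewrite nth_index //; move: BW; rewrite contig_arrowE // /in_arc; lia.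
Qed.

(** Consecutive semiblocks of a contig are always joined, so an ordering has to be cut into contigs
    at each of its gaps. *)
Lemma near_arrow i : i.+1 < size s -> contig_arrow c (nth set0 s i) (nth set0 s i.+1).
Proof.
move=> lt; rewrite contig_arrowE ?mem_nth // ?(ltnW lt) // !index_uniq ?(ltnW lt) //.
by have := far_step lt; rewrite /in_arc /=; lia.
Qed.

End ContigRound.

(** * Far neighbours and indistinguishable semiblocks *)

(* Without the two inclusions, the last clause would not make the elements between
   [x] and [y] twins of them: [u -> x -> y -> u] is a 3-cycle of twins. *)
Definition clones (A : eqType) (s : seq A) (r : rel A) (x y : A) :=
  [/\ r x y, {in s, forall u, r u x -> r u y}, {in s, forall u, r y u -> r x u}
    & {in s, forall u, [|| u == x, r u x | r x u] = [|| u == y, r u y | r y u]}].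

Lemma index_next (A : eqType) (s : seq A) x : uniq s -> x \in s ->
  index (next s x) s = if (index x s).+1 < size s then (index x s).+1 else 0.
Proof.
move=> us xs; rewrite next_nth xs; case: s us xs => // y p us xs.
have := xs; rewrite -index_mem; move: (index x _) => i ilt.
case: ifP => lt; first by rewrite -[nth _ _ _]/(nth y (y :: p) i.+1) index_uniq.
by rewrite nth_default ?index_head // leqNgt -ltnS lt.
Qed.

Section ContigFar.
Variables (T : finType) (c : contig T).
Let s := blocks c.
Let us : uniq s := blocks_uniq c.
Implicit Types B W X Y Z : {set T}.

Let idx B : B \in s -> index B s < size s := @index_blocks T c B.

Lemma eq_index B W : B \in s -> W \in s -> (index B s == index W s) = (B == W).
Proof. by move=> Bs Ws; rewrite (inj_in_eq (@index_inj _ set0 s)). Qed.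

Lemma contig_FlE B X : contig_Fl c B = Some X ->
  X \in s /\ {in s, forall W, contig_arrow c W B = (W != B) && in_arc (index X s) (index W s) (index B s)}.
Proof.
rewrite /contig_Fl; case: ifP => // Bs; case: pickP => // Z /andP[Zs /allP/= ZP] [<-].
split=> // W Ws; rewrite (eqP (ZP W Ws)) mem_range_co //.
by rewrite mem_range_cc.
Qed.

(** Among the semiblocks with an arrow to [B], the one farthest back works, since betweenness fills
    the range from it to [B]. If there is none, [B] itself works, its half-open range being
    empty. *)
Lemma contig_Fl_some B : B \in s -> exists X, contig_Fl c B = Some X.
Proof.
move=> Bs; rewrite /contig_Fl Bs; case: pickP => [X _|none]; first by exists X.
have [_ C2] := contig_round c; rewrite -/s in C2; have Bi := idx Bs.
have {}none X : X \in s ->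
    ~ {in s, forall W, contig_arrow c W B = (W != B) && in_arc (index X s) (index W s) (index B s)}.
  move=> Xs H; have := none X; rewrite Xs /= => /negP[]; apply/allP => W Ws.
  by rewrite H // mem_range_co // mem_range_cc // eqxx.
(* The number of steps from [W] forward to [B]. *)
pose d W := if index W s < index B s then index B s - index W s
            else index B s + size s - index W s.
case: (pickP (fun W => contig_arrow c W B)) => [W0 W0B|no]; last first.
  case: (none B Bs) => W Ws; rewrite no; symmetry; apply/negbTE.
  by rewrite -eq_index // /in_arc; lia.
have [X XB maxX] : exists2 X : {set T}, contig_arrow c X B &
    forall W, contig_arrow c W B -> d W <= d X.
  by case: (@arg_maxnP _ W0 (contig_arrow c ^~ B) d W0B) => X; exists X.
have /andP[Xs _] := arrow_blocks XB.
case: (none X Xs) => W Ws; apply/idP/andP.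
  move=> WB; have := maxX W WB; rewrite /d -eq_index //.
  have := idx Xs; have := idx Ws.
  have neq U : U \in s -> contig_arrow c U B -> index U s != index B s.
    by move=> Us; rewrite contig_arrowE // => /andP[]; rewrite eq_sym.
  have := neq _ Xs XB; have := neq _ Ws WB.
  by rewrite /in_arc; case: (ltnP (index W s) (index B s)); case: (ltnP (index X s) (index B s)) => /=; lia.
case=> WB aW; have [->//|WX] := eqVneq W X.
have/andP[] // : contig_arrow c X W && contig_arrow c W B.
apply: C2 => //; move: WB WX aW; rewrite -!eq_index // /in_arc /cyc; lia.
Qed.

Lemma contig_FrE B X : contig_Fr c B = Some X ->
  X \in s /\ {in s, forall W, contig_arrow c B W = (W != B) && in_arc (index B s) (index W s) (index X s)}.
Proof.
rewrite /contig_Fr; case: ifP => // Bs [<-]; split; first exact: far_r_blocks.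
by move=> W Ws; rewrite contig_arrowE // eq_index.
Qed.

(** Seen from [Z], arrows into [X] start in [[Z, X)], which is part of [[Z, Y)], and arrows out of
    [Y] end in [(Y, F]], which is part of [(X, F]]. Moreover [X] itself lies in [[Z, Y)], whence
    [X -> Y]. *)
Lemma indist_clones_of_arc X Y Z F : X \in s -> Y \in s -> X != Y ->
  contig_Fl c X = Some Z -> contig_Fl c Y = Some Z ->
  contig_Fr c X = Some F -> contig_Fr c Y = Some F ->
  in_arc (index Z s) (index X s) (index Y s) -> clones s (contig_arrow c) X Y.
Proof.
move=> Xs Ys; rewrite -eq_index // => XY /contig_FlE[Zs lX] /contig_FlE[_ lY].
move=> /contig_FrE[Fs rX] /contig_FrE[_ rY] ZXY.
have XaY : contig_arrow c X Y by rewrite lY // -eq_index // XY.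
have XYF : in_arc (index X s) (index Y s) (index F s) by move: XaY; rewrite rX // => /andP[].
split=> // U Us; rewrite ?lX ?lY ?rX ?rY // -!eq_index //; move: XY ZXY XYF; rewrite /in_arc; lia.
Qed.

(** One of [X] and [Y] comes first when the circle is read from their common left far neighbour [Z];
    the arrow goes from that one to the other. *)
Lemma indist_clones X Y : X \in s -> Y \in s -> X != Y ->
  contig_Fl c X = contig_Fl c Y -> contig_Fr c X = contig_Fr c Y ->
  clones s (contig_arrow c) X Y \/ clones s (contig_arrow c) Y X.
Proof.
move=> Xs Ys XY; case: (contig_Fl_some Ys) => Z lY; rewrite lY => lX.
have [F rY] : exists F, contig_Fr c Y = Some F by rewrite /contig_Fr Ys; eexists.
rewrite rY => rX.
have : in_arc (index Z s) (index X s) (index Y s) || in_arc (index Z s) (index Y s) (index X s).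
  by rewrite /in_arc; lia.
case/orP => ?; [left | right]; first exact: (@indist_clones_of_arc X Y Z F).
by apply: (@indist_clones_of_arc Y X Z F) => //; rewrite eq_sym.
Qed.

Lemma contig_R_some B W : contig_R c B = Some W <->
  [/\ B \in s, W \in s & index W s = (index B s).+1 \/
     [/\ circular c, (index B s).+1 = size s & index W s = 0]].
Proof.
rewrite /contig_R -/s; case Bs: (B \in s); last by split=> // -[].
have Bi := idx Bs.
have ni : index (next s B) s = if (index B s).+1 < size s then (index B s).+1 else 0.
  exact: index_next.
have s0 := size_blocks c; rewrite -/s in s0.
have lastE : (B == last set0 s) = (index B s == (size s).-1).
  rewrite -nth_last -eq_index ?mem_nth ?prednK // index_uniq ?prednK //.
have nE W' : W' \in s -> (next s B == W') = (index W' s == if (index B s).+1 < size s then (index B s).+1 else 0).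
  by move=> W's; rewrite -eq_index ?mem_next // ni eq_sym.
have ns : next s B \in s by rewrite mem_next.
rewrite /= lastE; split.
  case: ifP => // H [<-]; split=> //; rewrite ni; case: ltnP => lt; first by left.
  by right; split=> //; [case: circular H => //; lia | lia].
case=> _ Ws H; case: ifP => [_|].
  by congr Some; apply/eqP; rewrite nE //; have Wi := idx Ws; case: H => [|[_]]; case: ltnP => /=; lia.
by have := idx Ws; case: H => [|[-> //]]; lia.
Qed.

Lemma contig_R_none B : B \in s ->
  contig_R c B = None <-> ~~ circular c /\ (index B s).+1 = size s.
Proof.
move=> Bs; rewrite /contig_R -/s Bs /=; have s0 := size_blocks c; rewrite -/s in s0.
rewrite (_ : (B == last set0 s) = (index B s == (size s).-1)).
  by case: circular => //=; [split=> // -[] | case: eqP => /=; split=> //; lia].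
by rewrite -nth_last -eq_index ?mem_nth ?prednK // index_uniq ?prednK.
Qed.

Lemma contig_L_R B W : contig_L c B = Some W -> contig_R c W = Some B.
Proof.
rewrite /contig_L -/s; case: ifP => // /andP[Bs H] [<-].
have ps : prev s B \in s by rewrite mem_prev.
rewrite /contig_R -/s ps next_prev //=; case: ifP => // /norP[lin] /negPn /eqP E.
case/orP: H => [|/negP[]]; first by rewrite (negPf lin).
have := index_next us ps; rewrite next_prev // E.
have s0 := size_blocks c; rewrite -/s in s0.
have -> : index (last set0 s) s = (size s).-1 by rewrite -nth_last index_uniq ?prednK.
rewrite prednK // ltnn => i0.
by rewrite -nth0 -eq_index ?mem_nth // i0 index_uniq.
Qed.

Lemma contig_L_none B : B \in s ->
  contig_L c B = None <-> ~~ circular c /\ index B s = 0.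
Proof.
move=> Bs; rewrite /contig_L -/s Bs /=; have s0 := size_blocks c; rewrite -/s in s0.
rewrite (_ : (B == head set0 s) = (index B s == 0)).
  by case: circular => //=; [split=> // -[] | case: eqP => /=; split=> //; lia].
by rewrite -nth0 -eq_index ?mem_nth // index_uniq.
Qed.

End ContigFar.

(** * Round representations as families of contigs *)

Section RoundRep.
Variables (T : finType) (Phi : round_rep T).
Implicit Types (c : contig T) (B W : {set T}).
Local Notation cs := (contigs Phi).

Lemma vset_block c B : B \in blocks c -> B \subset contig_vset c.
Proof. by move=> Bc; rewrite /contig_vset (big_rem B) //= subsetUl. Qed.

(** Membership of contigs is [List.In], because a contig contains a function and has no decidable
    equality. *)
Lemma semiblocksP B : reflect (exists2 c, List.In c cs & B \in blocks c) (B \in semiblocks Phi).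
Proof.
rewrite /semiblocks; elim: (contigs Phi) => [|d l IH] /=; first by constructor; case.
rewrite mem_cat; case Bd: (B \in blocks d) => /=; first by constructor; exists d => //; left.
apply: (iffP IH) => -[c]; first by exists c => //; right.
by case=> [<-|]; [rewrite Bd | exists c].
Qed.

Lemma block_neq0 c B : B \in blocks c -> B != set0.
Proof. by move=> Bc; apply: contraNneq (blocks_neq_set0 c) => <-. Qed.

Lemma contig_of_in c B : List.In c cs -> B \in blocks c -> contig_of Phi B = Some c.
Proof.
rewrite /contig_of; have := contigs_disjoint Phi.
elim: (contigs Phi) => //= d l IH /andP[dl /IH{}IH] [-> ->|cl Bc] //.
case Bd: (B \in blocks d); last exact: IH.
have : [disjoint contig_vset d & contig_vset c].
  by elim: l cl dl {IH} => //= e l IH [->|cl] /andP[] // ? ?; exact: IH.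
move/(disjointWl (vset_block Bd))/(disjointWr (vset_block Bc)).
by rewrite -setI_eq0 setIid (negPf (block_neq0 Bc)).
Qed.

Lemma contig_ofP B c : contig_of Phi B = Some c -> List.In c cs /\ B \in blocks c.
Proof.
rewrite /contig_of; elim: (contigs Phi) => //= d l IH.
by case: ifP => [Bd [<-]|_ /IH[cl Bc]]; split=> //; [left | right].
Qed.

Lemma near_RE c B : List.In c cs -> B \in blocks c -> near_R Phi B = contig_R c B.
Proof. by move=> cl Bc; rewrite /near_R (contig_of_in cl Bc). Qed.

Lemma near_LE c B : List.In c cs -> B \in blocks c -> near_L Phi B = contig_L c B.
Proof. by move=> cl Bc; rewrite /near_L (contig_of_in cl Bc). Qed.

Lemma far_RE c B : List.In c cs -> B \in blocks c -> far_R Phi B = contig_Fr c B.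
Proof. by move=> cl Bc; rewrite /far_R (contig_of_in cl Bc). Qed.

Lemma far_LE c B : List.In c cs -> B \in blocks c -> far_L Phi B = contig_Fl c B.
Proof. by move=> cl Bc; rewrite /far_L (contig_of_in cl Bc). Qed.

Lemma arrowP B W : reflect (exists2 c, List.In c cs & contig_arrow c B W) (arrow Phi B W).
Proof.
rewrite /arrow; elim: (contigs Phi) => [|d l IH] /=; first by constructor; case.
case dBW: (contig_arrow d B W) => /=; first by constructor; exists d => //; left.
apply: (iffP IH) => -[c]; first by exists c => //; right.
by case=> [<-|]; [rewrite dBW | exists c].
Qed.

Lemma arrow_inl c B W : List.In c cs -> B \in blocks c -> arrow Phi B W = contig_arrow c B W.
Proof.
move=> cl Bc; apply/arrowP/idP => [[d dl BW]|]; last by exists c.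
have /andP[Bd _] := arrow_blocks BW; have := contig_of_in cl Bc.
by rewrite (contig_of_in dl Bd) => -[<-].
Qed.

Lemma arrow_inr c B W : List.In c cs -> W \in blocks c -> arrow Phi B W = contig_arrow c B W.
Proof.
move=> cl Wc; apply/arrowP/idP => [[d dl BW]|]; last by exists c.
have /andP[_ Wd] := arrow_blocks BW; have := contig_of_in cl Wc.
by rewrite (contig_of_in dl Wd) => -[<-].
Qed.

Lemma semiblocks_set0 : set0 \notin semiblocks Phi.
Proof. by apply/semiblocksP => -[c _ /block_neq0]; rewrite eqxx. Qed.

Lemma semiblocks_disjoint :
  pairwise (fun B W : {set T} => [disjoint B & W]) (semiblocks Phi).
Proof.
rewrite /semiblocks; have := contigs_disjoint Phi.
elim: (contigs Phi) => //= c l IH /andP[cl /IH{}IH].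
rewrite pairwise_cat blocks_disjoint IH !andbT /=; apply/allrelP => B W Bc.
move: cl; elim: l {IH} => //= d l IH /andP[cd /IH{}IH].
rewrite mem_cat => /orP[Wd|//].
exact: disjointWl (vset_block Bc) (disjointWr (vset_block Wd) cd).
Qed.

Lemma semiblocks_uniq : uniq (semiblocks Phi).
Proof. exact: disjoint_uniq semiblocks_set0 semiblocks_disjoint. Qed.

Lemma semiblock_eq B W x : B \in semiblocks Phi -> W \in semiblocks Phi ->
  x \in B -> x \in W -> B = W.
Proof.
have := semiblocks_disjoint; elim: (semiblocks Phi) => //= C l IH /andP[/allP dC /IH{}IH].
rewrite !inE => /orP[/eqP->|Bl] /orP[/eqP->|Wl] // xB xW; last exact: IH.
  by have /(disjointFr)/(_ xB) := dC _ Wl; rewrite xW.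
by have /(disjointFr)/(_ xW) := dC _ Bl; rewrite xB.
Qed.

Lemma contigs_split c : List.In c cs -> exists s1 s2, semiblocks Phi = s1 ++ blocks c ++ s2.
Proof.
rewrite /semiblocks; elim: (contigs Phi) => //= d l IH [->|/IH[s1 [s2 ->]]].
  by exists [::]; eexists.
by exists (blocks d ++ s1), s2; rewrite -catA.
Qed.

Lemma all_linear c : all (fun d => ~~ circular d) cs -> List.In c cs -> ~~ circular c.
Proof. by elim: (contigs Phi) => //= d l IH /andP[dl /IH{}IH] [<-|]. Qed.

Lemma linear_of c : 1 < size cs -> List.In c cs -> ~~ circular c.
Proof.
move=> lt; apply: all_linear; have := contigs_kind Phi.
by case: eqP lt => [->|].
Qed.

(** With a single contig this is [contig_round]. With several, all are linear and each occupies a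
    segment of the concatenation; an arrow [x -> z] goes forward inside its segment, so everything
    cyclically between [x] and [z] belongs to the same contig. *)
Lemma round_rep_round : round_on (semiblocks Phi) (index^~ (semiblocks Phi)) (arrow Phi).
Proof.
have asym : {in semiblocks Phi &, forall x y, arrow Phi x y -> ~~ arrow Phi y x}.
  move=> x y _ _ /arrowP[c cl xy]; have /andP[xc yc] := arrow_blocks xy.
  by rewrite (arrow_inl _ cl yc); apply: (contig_round c).1.
split=> // x y z xs ys zs cy /arrowP[c cl xz].
have /andP[xc zc] := arrow_blocks xz.
rewrite (arrow_inl _ cl xc) (arrow_inr _ cl zc).
suff [yc cyc'] : y \in blocks c /\ cyc (index x (blocks c)) (index y (blocks c)) (index z (blocks c)).
  by apply: (contig_round c).2.
have [/linear_of/(_ cl) lin|single] := ltnP 1 (size cs); last first.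
  move: single cl cy ys; rewrite /semiblocks; case: (contigs Phi) => [|d [|? ?]] //= _.
  by case=> // ->; rewrite cats0.
have := semiblocks_uniq; have [s1 [s2 E]] := contigs_split cl.
rewrite E in cy ys *; have lt := linear_arrow lin xz.
have zi := index_blocks zc; rewrite !cat_uniq => /and3P[_ /hasPn n1 /and3P[_ /hasPn n2 _]].
have iE w : w \in blocks c -> index w (s1 ++ blocks c ++ s2) = size s1 + index w (blocks c).
  by move=> wc; rewrite !index_cat wc (negPf (n1 w _)) // mem_cat wc.
move: cy; rewrite (iE x) // (iE z) // /cyc => cy.
have yc : y \in blocks c.
  move: ys; rewrite !mem_cat; case/or3P=> // ys.
    have : index y s1 < size s1 by rewrite index_mem.
    by move: cy; rewrite index_cat ys; lia.
  have y1 : y \notin s1 by apply: n1; rewrite mem_cat ys orbT.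
  by move: cy; rewrite !index_cat (negPf y1) (negPf (n2 y ys)) /=; lia.
by move: cy; rewrite iE //; split=> //; lia.
Qed.

(** The common left far neighbour puts both semiblocks in one contig, and semiblocks outside it have
    no arrow to or from either, so the clauses of [clones] extend to all semiblocks. *)
Lemma indistinguishable_clones X Y : X \in semiblocks Phi -> Y \in semiblocks Phi ->
  X != Y -> indistinguishable Phi X Y ->
  clones (semiblocks Phi) (arrow Phi) X Y \/ clones (semiblocks Phi) (arrow Phi) Y X.
Proof.
move=> /semiblocksP[c cl Xc] /semiblocksP[d dl Yd] XY [].
rewrite (far_LE cl Xc) (far_LE dl Yd) (far_RE cl Xc) (far_RE dl Yd) => eL eR.
have [Z lY] := contig_Fl_some Yd; have [Zd _] := contig_FlE lY.
have [Zc _] := contig_FlE (etrans eL lY).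
have E : d = c by move: (contig_of_in cl Zc); rewrite (contig_of_in dl Zd) => -[].
rewrite {}E in dl Yd eL eR {lY Zd}.
have lift A B : A \in blocks c -> B \in blocks c ->
    clones (blocks c) (contig_arrow c) A B -> clones (semiblocks Phi) (arrow Phi) A B.
  move=> Ac Bc [AB H1 H2 H3].
  have out U : U \notin blocks c -> [/\ ~~ contig_arrow c U A, ~~ contig_arrow c A U,
      ~~ contig_arrow c U B, ~~ contig_arrow c B U & ~~ ((U == A) || (U == B))].
    move=> Uc; split; try (by apply/negP => /arrow_blocks/andP[]; rewrite ?(negPf Uc)).
    by apply/negP => /orP[] /eqP E; rewrite E ?Ac ?Bc in Uc.
  have Al U : arrow Phi A U = contig_arrow c A U by exact: arrow_inl.
  have Ar U : arrow Phi U A = contig_arrow c U A by exact: arrow_inr.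
  have Bl U : arrow Phi B U = contig_arrow c B U by exact: arrow_inl.
  have Br U : arrow Phi U B = contig_arrow c U B by exact: arrow_inr.
  split=> [|U _|U _|U _]; first by rewrite Al.
  - rewrite Ar Br; case Uc: (U \in blocks c); first exact: H1.
    by have [/negPf-> _ _ _ _] := out U (negbT Uc).
  - rewrite Al Bl; case Uc: (U \in blocks c); first exact: H2.
    by have [_ _ _ /negPf-> _] := out U (negbT Uc).
  rewrite Al Bl Ar Br; case Uc: (U \in blocks c); first exact: H3.
  by have [/negPf-> /negPf-> /negPf-> /negPf-> /norP[/negPf-> /negPf->]] := out U (negbT Uc).
by case: (indist_clones Xc Yd XY eL eR) => ?; [left|right]; apply: lift.
Qed.

End RoundRep.

(** * Orderings recovered from near neighbours *)

Section NearPaths.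
Variables (T : finType) (Phi : round_rep T).
Implicit Types (c : contig T) (B W : {set T}) (t : seq {set T}).

Definition near (B W : {set T}) := near_R Phi B == Some W.

Lemma nearP B W : near B W ->
  exists2 c, List.In c (contigs Phi) & contig_R c B = Some W.
Proof.
rewrite /near /near_R; case E: (contig_of Phi B) => [c|//] /eqP /= R.
by have [cl _] := contig_ofP E; exists c.
Qed.

Lemma near_inj A B W : near A W -> near B W -> A = B.
Proof.
move=> /nearP[c cl /contig_R_some[Ac Wc AW]] /nearP[d dl /contig_R_some[Bd Wd BW]].
have E : d = c by move: (contig_of_in cl Wc); rewrite (contig_of_in dl Wd) => -[].
rewrite {}E in Bd BW; apply/eqP; rewrite -(eq_index Ac Bd); apply/eqP.
by case: AW BW => [->|[_ a b]] [|[_ a' b']]; lia.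
Qed.

Lemma near_semiblocks B W : near B W -> W \in semiblocks Phi.
Proof.
by case/nearP=> c cl /contig_R_some[_ Wc _]; apply/semiblocksP; exists c.
Qed.

(** The index is reduced modulo the size because the path may pass the closing point of a circular
    contig. *)
Lemma sorted_near_index c t : List.In c (contigs Phi) -> head set0 t \in blocks c ->
  sorted near t -> forall j, j < size t -> nth set0 t j \in blocks c /\
    index (nth set0 t j) (blocks c) = (index (head set0 t) (blocks c) + j) %% size (blocks c).
Proof.
move=> cl hc st; elim=> [|j IH] lt.
  by rewrite nth0 addn0 modn_small // index_blocks.
have [jc jE] := IH (ltnW lt); have := (sortedP set0 st) j lt.
rewrite /near (near_RE cl jc) => /eqP /contig_R_some[_ j1c j1E]; split=> //.
rewrite addnS -[(_ + j).+1]addn1 -modnDml -jE; have := index_blocks jc; have := index_blocks j1c.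
case: j1E => [-> lt1 _|[_ e ->] _ _]; first by rewrite addn1 modn_small.
by rewrite addn1 e modnn.
Qed.

(** This recovers a contig of a representation known only through near neighbours. A path that
    closes up runs around a whole circular contig, starting anywhere, hence the rotation by [k]; a
    path between two ends is a whole linear contig, and there [k] is 0. *)
Lemma sorted_near_contig t : t != [::] -> uniq t -> sorted near t ->
  {subset t <= semiblocks Phi} ->
  near (last set0 t) (head set0 t) \/
    near_R Phi (last set0 t) = None /\ (forall B, ~~ near B (head set0 t)) ->
  exists c k, [/\ List.In c (contigs Phi), k < size (blocks c), t = rot k (blocks c)
    & near_R Phi (last set0 t) = None -> k = 0].
Proof.
move=> tN ut st tP ends; have t0 : 0 < size t by rewrite lt0n size_eq0.
have ht : head set0 t \in t by rewrite -nth0 mem_nth.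
have /semiblocksP[c cl hc] := tP _ ht; exists c, (index (head set0 t) (blocks c)).
have nthE := sorted_near_index cl hc st; have hi := index_blocks hc.
have tc : {subset t <= blocks c}.
  by move=> B /(nthP set0)[j jt <-]; case: (nthE j jt).
have size_le : size t <= size (blocks c) by apply: uniq_leq_size.
have [lc lE] : last set0 t \in blocks c /\ index (last set0 t) (blocks c) =
    (index (head set0 t) (blocks c) + (size t).-1) %% size (blocks c).
  by rewrite -nth_last; apply: nthE; rewrite prednK.
(* If the path ends at a right end, the contig is linear, and a head at a positive position would
   have a left near neighbour. *)
have first0 : near_R Phi (last set0 t) = None -> index (head set0 t) (blocks c) = 0.
  case: ends => [/eqP->//|[_ no]]; rewrite (near_RE cl lc) => /(contig_R_none lc)[lin _].
  case E: (index _ _) => [|i] //; have /negP[] := no (nth set0 (blocks c) i).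
  have ilt : i < size (blocks c) by rewrite E in hi; apply: ltnW.
  rewrite /near (near_RE cl) ?mem_nth //; apply/eqP/contig_R_some.
  by rewrite mem_nth // index_uniq ?blocks_uniq //; split=> //; left.
have size_eq : size t = size (blocks c).
  move: ends; rewrite {1}/near (near_RE cl lc) => -[/eqP/contig_R_some[_ _]|[]].
    rewrite lE; move: (index _ _) hi => h hi.
    have [lt|ge] := ltnP (h + (size t).-1) (size (blocks c)).
      by rewrite modn_small // => -[|[_]]; lia.
    rewrite -(subnK ge) modnDr modn_small; last by lia.
    by case=> [|[_]]; lia.
  move=> lN _; have := first0; rewrite (near_RE cl lc) => /(_ lN) h0.
  have [_] := (contig_R_none lc).1 lN; rewrite lE h0 add0n modn_small; lia.
split=> //; apply: (@eq_from_nth _ set0); first by rewrite size_rot.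
move=> j jt; have [jc jE] := nthE j jt.
rewrite -[LHS](nth_index set0 jc) jE {jE}.
have := hi; move: (index _ _) => h hlt.
rewrite size_eq in jt; rewrite /rot nth_cat size_drop nth_drop.
case: ltnP => lt; first by rewrite modn_small //; lia.
rewrite nth_take; last by lia.
have -> : h + j = j - (size (blocks c) - h) + size (blocks c) by lia.
by rewrite modnDr modn_small //; lia.
Qed.

End NearPaths.

Lemma sorted_near_blocks (T : finType) (Phi : round_rep T) c :
  List.In c (contigs Phi) -> sorted (near Phi) (blocks c).
Proof.
move=> cl; apply/(sortedP set0) => j lt; rewrite /near (near_RE cl) ?mem_nth ?(ltnW lt) //.
apply/eqP/contig_R_some; rewrite !mem_nth ?(ltnW lt) // !index_uniq ?(ltnW lt) ?blocks_uniq //.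
by split=> //; left.
Qed.

(** * The range of a receptive pair *)

Lemma in_arcl i k : in_arc i i k.
Proof. by rewrite /in_arc; lia. Qed.

Lemma in_arcr i k : in_arc i k k.
Proof. by rewrite /in_arc; lia. Qed.

Lemma in_arc_rot (A : eqType) (s : seq A) k x w y : uniq s -> k <= size s ->
  x \in s -> w \in s -> y \in s ->
  in_arc (index x (rot k s)) (index w (rot k s)) (index y (rot k s)) =
  in_arc (index x s) (index w s) (index y s).
Proof.
move=> us k_le xs ws ys; rewrite -(mem_range_cc us xs ys ws) -mem_range_cc ?rot_uniq ?mem_rot //.
by rewrite range_cc_rot.
Qed.

Section Deletion.
Variables (T : finType) (v : T) (Phi Psi : round_rep T).
Implicit Types (c d : contig T) (A B W : {set T}).
Let V := [set v].
Hypothesis del : deletion Psi v Phi.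

Lemma mem_deletion B : (B \in semiblocks Phi) = (B != V) && (B \in semiblocks Psi).
Proof. by case: del => -> _ _; rewrite inE. Qed.

Lemma arrow_deletion : {in semiblocks Phi &, arrow Phi =2 arrow Psi}.
Proof. by case: del. Qed.

Lemma near_deletion A B : near Phi A B ->
  near Psi A B \/ near Psi A V /\ near Psi V B.
Proof.
move=> AB; have [c cl /contig_R_some[Ac Bc _]] := nearP AB.
have AP : A \in semiblocks Phi by apply/semiblocksP; exists c.
case: del => _ /(_ _ AP) + _; case: ifP => [AV|_ E]; last by left; rewrite /near -E.
move: AB; rewrite /near => /eqP-> [E|//]; right; split=> //.
by rewrite /near -E.
Qed.

Lemma near_undeleted A B : A \in semiblocks Phi -> B != V -> near Psi A B -> near Phi A B.
Proof.
move=> AP BV AB; case: del => _ /(_ _ AP) + _.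
by rewrite /near (eqP AB) -/V eqE /= (negPf BV) => ->.
Qed.

Lemma near_deletion_end A : A \in semiblocks Phi -> near Psi A V ->
  near_R Phi A = near_R Psi V \/ near_R Phi A = None.
Proof. by move=> AP; rewrite /near => AV; case: del => _ /(_ _ AP) + _; rewrite AV. Qed.

Lemma sorted_deletion (t : seq {set T}) : {subset t <= semiblocks Phi} ->
  sorted (near Psi) t -> sorted (near Phi) t.
Proof.
move=> tP /(sortedP set0) st; apply/(sortedP set0) => j lt.
have [/tP jP] : nth set0 t j \in t by rewrite mem_nth ?(ltnW lt).
have [/tP] : nth set0 t j.+1 \in t by rewrite mem_nth.
by rewrite mem_deletion => /andP[jV _]; apply: near_undeleted => //; apply: st.
Qed.

Lemma rr_range_same c A B : List.In c (contigs Phi) -> A \in blocks c -> B \in blocks c ->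
  rr_range Phi A B = range_cc (blocks c) A B.
Proof. by move=> cl Ac Bc; rewrite /rr_range (contig_of_in cl Ac) (contig_of_in cl Bc) Bc. Qed.

Section Reception.
Variables Bl Br : {set T}.
Hypotheses (VP : V \in semiblocks Psi) (BlP : Bl \in semiblocks Phi) (BrP : Br \in semiblocks Phi).
Hypothesis BlE : (if left_end Psi V then near_R Psi V else far_L Psi V) = Some Bl.
Hypothesis BrE : (if right_end Psi V then near_L Psi V else far_R Psi V) = Some Br.

Section Contig.
Variable d : contig T.
Hypotheses (dl : List.In d (contigs Psi)) (Vd : V \in blocks d).
Let s := blocks d.
Let i := index V s.
Let t := drop i.+1 s ++ take i s.
Let us : uniq s := blocks_uniq d.
Let ilt : i < size s := index_blocks Vd.

Lemma blockV B : B \in s -> (B \in semiblocks Phi) = (B != V).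
Proof.
by move=> Bs; rewrite mem_deletion (_ : B \in semiblocks Psi) ?andbT //; apply/semiblocksP; exists d.
Qed.

(** Deleting [V] leaves the path [t] that begins after [V]; in [Phi] it is a circular contig again,
    or a linear one cut at the place of [V]. Since [Br] comes before [Bl] in [t], the range from
    [Bl] to [Br] wraps around the end of [t]; for the linear contig this rests on indices being
    taken modulo the size. *)
Lemma reception_circular W : circular d ->
  (W \in rr_range Phi Bl Br) =
  (W \in semiblocks Phi) && (contig_arrow d W V || contig_arrow d V W).
Proof.
move=> circ; have rE : rot i s = V :: t by rewrite /i rot_index.
have notL : left_end Psi V = false.
  by apply/negbTE/eqP; rewrite (near_LE dl Vd) => /(contig_L_none Vd); rewrite circ => -[].
have notR : right_end Psi V = false.
  by apply/negbTE/eqP; rewrite (near_RE dl Vd) => /(contig_R_none Vd); rewrite circ => -[].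
move: BlE BrE; rewrite notL notR (far_LE dl Vd) (far_RE dl Vd).
move=> /contig_FlE[Bls Lar] /contig_FrE[Brs Rar].
have BlV : Bl != V by rewrite -blockV.
have BrV : Br != V by rewrite -blockV.
have cy : cycle (near Psi) (V :: t).
  rewrite -rE rot_cycle; have := sorted_near_blocks dl; rewrite -/s.
  have s0 : 0 < size s by apply: leq_trans ilt.
  have : near Psi (last set0 s) (head set0 s).
    have s1 : (size s).-1 < size s by rewrite prednK.
    rewrite /near (near_RE dl); last by rewrite -nth_last mem_nth.
    apply/eqP/contig_R_some; rewrite -nth_last -nth0 !mem_nth // !index_uniq //.
    by split=> //; right; split=> //; rewrite prednK.
  by case: (s) => //= x p; rewrite rcons_path => -> ->.
have ut : uniq (V :: t) by rewrite -rE rot_uniq.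
have ts B : (B \in t) = (B != V) && (B \in s).
  have := mem_rot i s B; rewrite rE inE.
  by have [->|//] := eqVneq B V; move/andP: ut => [/negPf].
have tP : {subset t <= semiblocks Phi}.
  by move=> B; rewrite ts => /andP[BV Bs]; rewrite blockV.
have Blt : Bl \in t by rewrite ts BlV.
have Brt : Br \in t by rewrite ts BrV.
have tN : t != [::] by case: (t) Blt.
have [VH st LV] : [/\ near Psi V (head set0 t), sorted (near Psi) t & near Psi (last set0 t) V].
  by move: cy tN; case: (t) => //= x q; rewrite rcons_path => /and3P[].
have lP : last set0 t \in semiblocks Phi by apply: tP; case: (t) tN => //= x q _; apply: mem_last.
(* The only predecessor of the head in [Psi] is [V], so if the last element of [t] does not become
   its predecessor in [Phi], nothing does. *)
have ends : near Phi (last set0 t) (head set0 t) \/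
    near_R Phi (last set0 t) = None /\ (forall B, ~~ near Phi B (head set0 t)).
  have [E|E] := near_deletion_end lP LV; first by left; rewrite /near E.
  right; split=> // B; apply/negP => BH; have [BH'|[BV _]] := near_deletion BH.
    by have [c cl /contig_R_some[Bc _ _]] := nearP BH;
       have : B \in semiblocks Phi; [apply/semiblocksP; exists c|
       rewrite (near_inj BH' VH) mem_deletion eqxx].
  by move: BH; rewrite (near_inj BV LV) /near E.
have /andP[_ ut'] := ut.
have [c [k [cl klt tE _]]] := sorted_near_contig tN ut' (sorted_deletion tP st) tP ends.
have tc B : (B \in blocks c) = (B \in t) by rewrite tE mem_rot.
rewrite (rr_range_same cl) ?tc //.
rewrite -(range_cc_rot (blocks_uniq c) (k := k)) ?tc ?(ltnW klt) // -tE.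
case Wt: (W \in t); last first.
  have -> : (W \in range_cc t Bl Br) = false by apply: contraFF Wt; apply: range_cc_sub.
  case WP : (W \in semiblocks Phi) => //=; symmetry; apply: contraFF Wt.
  have WV : W != V by move: WP; rewrite mem_deletion => /andP[].
  by rewrite ts WV; case/orP=> /arrow_blocks/andP[].
have := Wt; rewrite ts => /andP[WV Ws].
rewrite blockV // WV /= mem_range_cc // Lar // Rar // WV /=.
(* By asymmetry [Br] has no arrow back to [V], so it lies outside [[Bl, V)] and hence strictly
   before [Bl] in [t]. *)
have VBr : contig_arrow d V Br by rewrite Rar // BrV in_arcr.
have := (contig_round d).1 _ _ Vd Brs VBr; rewrite Lar // BrV /=.
rewrite -!(in_arc_rot us (ltnW ilt)) // rE /= eqxx !(eq_sym V).
rewrite (negPf BlV) (negPf BrV) (negPf WV) /in_arc.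
by move: (index Bl t) (index W t) (index Br t) => a b e; clear; lia.
Qed.

(** [l] and [r] are the parts of the contig on the two sides of [V]. In [Phi] they are two contigs
    if both are nonempty and the junction is not closed up; otherwise [l ++ r] is one contig. In
    either case the range consists of the part of [l] from [Bl] on, if any, and the part of [r] up
    to [Br], if any. *)
Lemma reception_linear W : ~~ circular d ->
  (W \in rr_range Phi Bl Br) =
  (W \in semiblocks Phi) && (contig_arrow d W V || contig_arrow d V W).
Proof.
move=> lin; set l := take i s; set r := drop i.+1 s.
have sE : s = l ++ V :: r.
  by rewrite -[LHS](cat_take_drop i) (drop_nth set0) // nth_index.
have szl : size l = i by rewrite size_takel // ltnW.
have s0 : size s = (i + size r).+1 by rewrite sE size_cat szl /= addnS.
(* If [V] is a left end, no arrow reaches it and [Bl] is at position 1; the condition on [U] is then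
   false because [i] is 0, so one formula covers both cases. *)
have [Bls Lar L0 L1] : [/\ Bl \in s,
    {in s, forall U, contig_arrow d U V = (index Bl s <= index U s < i)},
    i = 0 -> index Bl s = 1 & i != 0 -> index Bl s < i].
  case E : (left_end Psi V) BlE; last first.
    have i0 : i != 0.
      apply: contraFN E => /eqP i0; rewrite /left_end (near_LE dl Vd).
      by apply/eqP/(contig_L_none Vd).
    rewrite (far_LE dl Vd) => /contig_FlE[Bls Lar]; have lt : index Bl s < i.
      by apply: linear_arrow => //; rewrite Lar // -blockV // BlP in_arcl.
    split=> // [U Us|i0']; last by rewrite i0' in i0.
    rewrite Lar // -(eq_index Us Vd) -/s -/i /in_arc.
    by move: lt (index U s); clear; lia.
  move: E; rewrite /left_end (near_LE dl Vd) => /eqP/(contig_L_none Vd)[_ i0].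
  rewrite (near_RE dl Vd) => /contig_R_some[_ Bls BlE']; rewrite -/s -/i in i0 BlE'.
  split=> //; try by case: BlE' => [|[cd]]; [lia | rewrite cd in lin].
  move=> U Us; rewrite i0 ltn0 andbF; apply/negP => /(linear_arrow lin).
  by rewrite -/s -/i i0.
(* Symmetrically, for a right end [V] the position of [Br] is one less than [i], and no [U]
   satisfies the condition. *)
have [Brs Rar R0 R1] : [/\ Br \in s,
    {in s, forall U, contig_arrow d V U = (i < index U s <= index Br s)},
    i.+1 = size s -> (index Br s).+1 = i & i.+1 < size s -> i < index Br s].
  case E : (right_end Psi V) BrE; last first.
    have i0 : i.+1 != size s.
      apply: contraFN E => /eqP i0; rewrite /right_end (near_RE dl Vd).
      by apply/eqP/(contig_R_none Vd).
    rewrite (far_RE dl Vd) => /contig_FrE[Brs Rar]; have lt : i < index Br s.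
      by apply: linear_arrow => //; rewrite Rar // -blockV // BrP in_arcr.
    split=> // [U Us|i0']; last by rewrite i0' eqxx in i0.
    rewrite Rar // -(eq_index Us Vd) -/s -/i /in_arc.
    by move: lt (index U s); clear; lia.
  move: E; rewrite /right_end (near_RE dl Vd) => /eqP/(contig_R_none Vd)[_ i0].
  rewrite (near_LE dl Vd) => /contig_L_R/contig_R_some[Brs _ BrE']; rewrite -/s -/i in i0 BrE'.
  have {}BrE' : i = (index Br s).+1 by case: BrE' => // -[cd]; rewrite cd in lin.
  split=> // [U Us|]; last by rewrite i0 ltnn.
  have Ui := index_blocks Us; rewrite -/s in Ui.
  have -> : (i < index U s <= index Br s) = false by lia.
  by apply/negP => /(linear_arrow lin); rewrite -/s -/i; lia.
(* Near neighbours in [Phi] do not leave the contig: they are one position apart in [s], or two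
   apart across [V]. *)
have nearI A B : near Phi A B -> (A \in s) || (B \in s) ->
    [/\ A \in s, B \in s, index A s != i, index B s != i &
        index B s = (index A s).+1 \/ (index A s).+1 = i /\ index B s = i.+1].
  have nearI A' B' : near Psi A' B' -> (A' \in s) || (B' \in s) ->
      [/\ A' \in s, B' \in s & index B' s = (index A' s).+1].
    case/nearP=> c cl /contig_R_some[Ac Bc cAB] ABs.
    have E : d = c.
      case/orP: ABs => Xs; first by move: (contig_of_in cl Ac); rewrite (contig_of_in dl Xs) => -[].
      by move: (contig_of_in cl Bc); rewrite (contig_of_in dl Xs) => -[].
    rewrite -E -/s in Ac Bc cAB; split=> //; by case: cAB => // -[cc]; rewrite cc in lin.
  move=> AB ABs; have [As' Bs'] : A != V /\ B != V.
    have := near_semiblocks AB; rewrite mem_deletion => /andP[-> _].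
    have [c cl /contig_R_some[Ac _ _]] := nearP AB.
    have : A \in semiblocks Phi by apply/semiblocksP; exists c.
    by rewrite mem_deletion => /andP[].
  have [As Bs H] : [/\ A \in s, B \in s & index B s = (index A s).+1 \/ (index A s).+1 = i /\ index B s = i.+1].
    have [AB'|[AV VB]] := near_deletion AB.
      by have [? ? ?] := nearI _ _ AB' ABs; split=> //; left.
    have [As _ iE] : [/\ A \in s, V \in s & i = (index A s).+1] by apply: nearI => //; rewrite Vd orbT.
    have VBs : (V \in s) || (B \in s) by rewrite Vd.
    by have [_ Bs BE] := nearI _ _ VB VBs; split=> //; right.
  by split; rewrite // /i (eq_index _ Vd).
have lV U : (U \in l) = (U \in s) && (index U s < i).
  apply/idP/andP => [Ul|[Us]]; last by rewrite -in_take.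
  by have Us := mem_take Ul; split=> //; rewrite -in_take.
have [nl nr] : V \notin l /\ V \notin r.
  have := us; rewrite sE cat_uniq => /and3P[_ /hasPn nl /andP[Vr _]].
  by split=> //; apply: nl; rewrite inE eqxx.
have rV U : (U \in r) = (U \in s) && (i < index U s).
  have [->|UV] := eqVneq U V; first by rewrite (negPf nr) -/i ltnn andbF.
  have [Us|Us] := boolP (U \in s); last first.
    by apply: contraNF Us => Ur; rewrite sE mem_cat inE Ur !orbT.
  have : (U \in l) || (U \in r) by move: Us; rewrite sE mem_cat inE (negPf UV).
  have := us; rewrite {1}sE cat_uniq => /and3P[_ /hasPn/(_ U) + _].
  rewrite inE (negPf UV) lV Us /=; have : index U s != i by rewrite (eq_index Us Vd).
  by case: (U \in r) => ne; [move/(_ isT) | move=> _]; move: (index U s) ne; clear; lia.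
have idxr U : U \in r -> index U s = (i + index U r).+1.
  move=> Ur; rewrite {1}sE index_cat lV; move: (Ur); rewrite rV => /andP[-> iU].
  rewrite ltnNge (ltnW iU) /= szl; have [UV|_] := eqVneq V U; last by rewrite addnS.
  by rewrite UV Ur in nr.
have idxl U : U \in l -> index U s = index U l.
  by move=> Ul; rewrite {1}sE index_cat Ul.
have [lP rP] : {subset l <= semiblocks Phi} /\ {subset r <= semiblocks Phi}.
  split=> U Ux; rewrite blockV; move: (Ux); rewrite ?lV ?rV => /andP[Us _] //.
    by apply: contraNneq nl => <-.
  by apply: contraNneq nr => <-.
have ss := sorted_near_blocks dl; rewrite -/s in ss.
have [sl sr] : sorted (near Phi) l /\ sorted (near Phi) r.
  by split; apply: sorted_deletion => //; rewrite ?take_sorted ?drop_sorted.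
have [ul ur] : uniq l /\ uniq r by rewrite take_uniq ?drop_uniq.
have Wlr : (W \in semiblocks Phi) && (contig_arrow d W V || contig_arrow d V W) =
    (W \in l) && (index Bl s <= index W s) || (W \in r) && (index W s <= index Br s).
  rewrite lV rV; have [Ws|Ws] := boolP (W \in s); last first.
    by rewrite /= andbC; apply/negbTE/negP => /andP[/orP[] /arrow_blocks/andP[]]; rewrite -/s (negPf Ws).
  rewrite blockV // Lar // Rar //; have := eq_index Ws Vd; rewrite -/s -/i => <-.
  by move: (index W s) (index Bl s) (index Br s); clear; lia.
rewrite {}Wlr.
have hd_mem (q : seq {set T}) : q != [::] -> head set0 q \in q.
  by case: q => //= x q _; rewrite inE eqxx.
have lst_mem (q : seq {set T}) : q != [::] -> last set0 q \in q.
  by case: q => //= x q _; apply: mem_last.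
have hd_idx (q : seq {set T}) : index (head set0 q) q = 0 by case: q => //= x q; rewrite eqxx.
have lst_idx (q : seq {set T}) : uniq q -> q != [::] -> index (last set0 q) q = (size q).-1.
  by move=> uq qN; rewrite -nth_last index_uniq // prednK // lt0n size_eq0.
have none A : (forall B, ~~ near Phi A B) -> near_R Phi A = None.
  by rewrite /near; case: near_R => // B /(_ B); rewrite eqxx.
(* A path from a left end to a right end is the whole of a contig, without rotation. *)
have mk (q : seq {set T}) : q != [::] -> uniq q -> sorted (near Phi) q -> {subset q <= semiblocks Phi} ->
    near_R Phi (last set0 q) = None -> (forall B, ~~ near Phi B (head set0 q)) ->
    exists2 c, List.In c (contigs Phi) & blocks c = q.
  move=> qN uq sq qP qE qH.
  have [c [k [cl _ qc /(_ qE) k0]]] := sorted_near_contig qN uq sq qP (or_intror (conj qE qH)).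
  by exists c => //; rewrite qc k0 rot0.
have indexlt U : U \in s -> index U s < size s := @index_blocks _ d U.
have Blr : Bl \in l ++ r.
  have : index Bl s != i by rewrite (eq_index Bls Vd) -blockV.
  by rewrite mem_cat lV rV Bls /=; move: (index Bl s); clear; lia.
have Brr : Br \in l ++ r.
  have : index Br s != i by rewrite (eq_index Brs Vd) -blockV.
  by rewrite mem_cat lV rV Brs /=; move: (index Br s); clear; lia.
(* The contig really splits: there are semiblocks on both sides of [V] and no near neighbour
   across. *)
have [/and3P[i0 i1 /eqP lN]|lN] := boolP [&& i != 0, i.+1 != size s & near_R Phi (last set0 l) == None].
  have lne : l != [::] by rewrite -size_eq0 szl.
  have rne : r != [::] by apply: contraNneq i1 => r0; rewrite s0 r0 addn0.
  have hl : index (head set0 l) s = 0 by rewrite idxl ?hd_mem.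
  have ll : index (last set0 l) s = i.-1 by rewrite idxl ?lst_mem // lst_idx // szl.
  have hr : index (head set0 r) s = i.+1 by rewrite idxr ?hd_mem // hd_idx addn0.
  have lr : index (last set0 r) s = (size s).-1.
    by rewrite idxr ?lst_mem // lst_idx // s0 -addnS prednK // lt0n size_eq0.
  have ms := (hd_mem _ lne, hd_mem _ rne, lst_mem _ lne, lst_mem _ rne).
  have [c1 cl1 c1E] : exists2 c, List.In c (contigs Phi) & blocks c = l.
    apply: mk => // B; apply/negP => /nearI; have := ms.1.1.1; rewrite lV => /andP[-> _].
    rewrite orbT hl => /(_ isT)[_ _ _ _]; move: (index B s); clear; lia.
  have [c2 cl2 c2E] : exists2 c, List.In c (contigs Phi) & blocks c = r.
    apply: mk => //.
      apply: none => B; apply/negP => /nearI; have := ms.2; rewrite rV => /andP[-> _].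
      rewrite lr => /(_ isT)[_ /indexlt]; move: (index B s) s0 i1; clear; lia.
    move=> B; apply/negP => BH; have := ms.1.1.2; rewrite rV => /andP[hrs _].
    have [|Bs _ Bi _] := nearI _ _ BH; first by rewrite hrs orbT.
    rewrite hr => -[BE|[BE _]]; first by move: Bi BE; clear; lia.
    have BL : B = last set0 l.
      apply/eqP; rewrite -(eq_index (c := d)) //; last by have := ms.1.2; rewrite lV => /andP[].
      by rewrite -/s ll -BE.
    by move: BH; rewrite BL /near lN.
  have Bll : Bl \in l by rewrite lV Bls L1.
  have Brr' : Br \in r by rewrite rV Brs R1 //; move: i1 ilt; clear; lia.
  have Brl : (Br \in l) = false by apply/negbTE; rewrite lV Brs -leqNgt ltnW //; move: Brr'; rewrite rV => /andP[].
  rewrite /rr_range (contig_of_in cl1) ?c1E // (contig_of_in cl2) ?c2E // Brl mem_cat.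
  congr (_ || _).
    have [Wl|Wl] := boolP (W \in l); last by apply: contraNF Wl; apply: range_cc_sub.
    rewrite mem_range_cc ?ms // lst_idx // /in_arc -!idxl //= szl.
    move: Wl (L1 i0); rewrite lV => /andP[_]; move: (index W s) (index Bl s) i0; clear; lia.
  have [Wr|Wr] := boolP (W \in r); last by apply: contraNF Wr; apply: range_cc_sub.
  rewrite mem_range_cc ?ms // hd_idx /in_arc !idxr //=; clear; lia.
have nearmk A B : A \in s -> B \in s -> index B s = (index A s).+1 -> near Psi A B.
  move=> As Bs E; rewrite /near (near_RE dl As); apply/eqP/contig_R_some.
  by split=> //; left.
have une : l ++ r != [::] by case: (l ++ r) Blr.
have uu : uniq (l ++ r).
  rewrite cat_uniq ul ur andbT; apply/hasPn => U; rewrite rV lV => /andP[-> ?] /=.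
  by rewrite -leqNgt ltnW.
(* From the place of [V] on, positions in [l ++ r] are one less than those in [s]. *)
have idx U : U \in l ++ r -> index U s = if index U (l ++ r) < i then index U (l ++ r) else (index U (l ++ r)).+1.
  rewrite mem_cat index_cat szl; case Ul: (U \in l) => /= Ur.
    by rewrite idxl // ifT // -szl index_mem.
  by rewrite idxr // ifF //; apply/negbTE; rewrite -leqNgt leq_addr.
have us' U : U \in l ++ r -> U \in s /\ U != V.
  rewrite mem_cat => UU; split; first by case/orP: UU; rewrite ?lV ?rV => /andP[].
  by apply: contraTneq UU => ->; rewrite (negPf nl).
have szu : size (l ++ r) = (size s).-1 by rewrite size_cat szl s0.
have [hu lu] : head set0 (l ++ r) \in l ++ r /\ last set0 (l ++ r) \in l ++ r by split; [apply: hd_mem | apply: lst_mem].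
have hus : index (head set0 (l ++ r)) s = (i == 0).
  by rewrite idx // hd_idx lt0n; case: (i).
have lus : index (last set0 (l ++ r)) s = if i.+1 == size s then i.-1 else (size s).-1.
  rewrite idx // lst_idx // szu; move: ilt s0; have : 0 < size (l ++ r) by rewrite lt0n size_eq0.
  rewrite szu; move: (size s) => n; clear; case: ifP; case: ifP; lia.
have [c cl cE] : exists2 c, List.In c (contigs Phi) & blocks c = l ++ r.
  apply: mk => //.
  - case lne: (l == [::]); first by rewrite (eqP lne).
    case rne: (r == [::]); first by rewrite (eqP rne) cats0.
    have i0 : i != 0 by rewrite -szl size_eq0 lne.
    have i1 : i.+1 != size s by rewrite s0 -{1}[i]addn0 eqSS eqn_add2l eq_sym size_eq0 rne.
    have lr : near Phi (last set0 l) (head set0 r).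
      have [/negbT lne' /negbT rne'] := (lne, rne).
      have := lst_mem _ lne'; rewrite lV => /andP[lls _].
      have := hd_mem _ rne'; rewrite rV => /andP[hrs _].
      have nlV : near Psi (last set0 l) V.
        apply: nearmk => //; rewrite (idxl (last set0 l)) ?lst_mem // lst_idx // szl.
        by rewrite prednK // lt0n.
      have nVr : near Psi V (head set0 r).
        by apply: nearmk => //; rewrite idxr ?hd_mem // hd_idx addn0.
      have lP' : last set0 l \in semiblocks Phi by apply: lP; apply: lst_mem; rewrite lne.
      have [E|E] := near_deletion_end lP' nlV; first by rewrite /near E.
      by move: lN; rewrite i0 i1 E eqxx.
    case: (l) (r) lne rne sl sr lr => [|x q] [|y p] //= _ _ sl' sr' lr.
    by rewrite cat_path sl' /= lr.
  - by move=> U; rewrite mem_cat => /orP[/lP|/rP].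
  - apply: none => B; apply/negP => /nearI; have [-> _] := us' _ lu; move=> /(_ isT).
    rewrite lus => -[_ /indexlt]; case: ifP => /eqP; move: (index B s) ilt; clear; lia.
  move=> B; apply/negP => /nearI; have [-> _] := us' _ hu; rewrite orbT => /(_ isT)[_ _ + _].
  by rewrite hus; move: (index B s); clear; case: (i) => [|j]; lia.
rewrite (rr_range_same cl) ?cE //.
have [Wu|] := boolP (W \in l ++ r); last first.
  rewrite mem_cat negb_or => /andP[Wl Wr]; rewrite (negPf Wl) (negPf Wr) /=.
  by apply/negP => /range_cc_sub; rewrite mem_cat (negPf Wl) (negPf Wr).
rewrite mem_range_cc // lV rV /in_arc; have [-> _] := us' _ Wu => /=.
have iu U : U \in l ++ r -> index U (l ++ r) < (size s).-1 by rewrite -szu index_mem.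
move: (idx _ Wu) (idx _ Blr) (idx _ Brr) (iu _ Wu) (iu _ Blr) (iu _ Brr) L0 L1 R0 R1 ilt.
move: (index W (l ++ r)) (index Bl (l ++ r)) (index Br (l ++ r)) => w' bl' br'.
move: (index W s) (index Bl s) (index Br s) (size s) => w bl br n; clear.
by case: (ltnP w' i); case: (ltnP bl' i); case: (ltnP br' i); lia.
Qed.

End Contig.

Lemma rr_range_reception W :
  (W \in rr_range Phi Bl Br) =
  (W \in semiblocks Phi) && (arrow Psi W V || arrow Psi V W).
Proof.
have /semiblocksP[d dl Vd] := VP.
rewrite (arrow_inl _ dl Vd) (arrow_inr _ dl Vd).
by have [|] := boolP (circular d); [apply: reception_circular | apply: reception_linear].
Qed.

End Reception.
End Deletion.

(** * Round representations from arrow relations *)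

Lemma filter_prefix (A : Type) (x0 : A) (a : pred A) (t : seq A) :
  (forall i j, i < j < size t -> a (nth x0 t j) -> a (nth x0 t i)) ->
  filter a t = take (count a t) t.
Proof.
elim: t => //= x t IH H; case ax: (a x) => /=.
  by congr cons; apply: IH => i j lt; apply: (H i.+1 j.+1).
have no : count a t = 0.
  apply/eqP; rewrite -leqn0 leqNgt -has_count; apply/(has_nthP x0) => -[j jt aj].
  by have := H 0 j.+1 jt aj; rewrite /= ax.
by rewrite no; apply: size0nil; rewrite size_filter.
Qed.

Section FarOfRelation.
Variables (A : eqType) (s : seq A) (r : rel A).
Hypotheses (us : uniq s) (round_s : round_on s (index^~ s) r).

(** The ordering is read around the circle from [x] on; the default [x] of [last] makes an element
    without outgoing arrows its own far neighbour. *)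
Definition far_of (x : A) := last x (filter (r x) (rot (index x s) s)).

Lemma round_irr x : x \in s -> r x x = false.
Proof. by move=> xs; apply/negP => rxx; have := round_s.1 x x xs xs rxx; rewrite rxx. Qed.

(** By betweenness the targets of arrows from [x] form an initial segment of what follows [x], so
    the range up to the last target contains nothing else. *)
Lemma range_far_of x : x \in s -> range_oc s x (far_of x) = filter (r x) (rot (index x s) s).
Proof.
move=> xs; rewrite /range_oc /range_cc /far_of; have rE := rot_index xs.
set t := drop _ _ ++ take _ _ in rE.
have ut : uniq (x :: t) by rewrite -rE rot_uniq.
rewrite rE (_ : filter (r x) (x :: t) = filter (r x) t); last by rewrite /= round_irr.
have -> : filter (r x) t = take (count (r x) t) t.
  apply: (@filter_prefix _ x) => i j /andP[ij jt] rj.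
  have [it' jt'] : nth x t i \in s /\ nth x t j \in s.
    by split; rewrite -(mem_rot (index x s)) rE inE mem_nth ?orbT // (ltn_trans ij).
  have xlt : index x s < size s by rewrite index_mem.
  have idx k : k < size t -> index (nth x t k) (rot (index x s) s) = k.+1.
    by move=> kt; rewrite rE -[nth x t k]/(nth x (x :: t) k.+1) index_uniq.
  have := idx i (ltn_trans ij jt); have := idx j jt.
  have ilt : index (nth x t i) s < size s by rewrite index_mem.
  have jlt : index (nth x t j) s < size s by rewrite index_mem.
  rewrite !index_rot // ?(ltnW xlt) // => jE iE.
  suff cy : cyc (index x s) (index (nth x t i) s) (index (nth x t j) s).
    by case/andP: (round_s.2 _ _ _ xs it' jt' cy rj).
  move: (index x s) (index (nth x t i) s) (index (nth x t j) s) (size s) xlt ilt jlt iE jE ij.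
  clear=> a b e n; rewrite /cyc; case: ifP; case: ifP; lia.
set k := count _ _; have kt : k <= size t := count_size _ _.
have -> : last x (take k t) = nth x (x :: t) k.
  rewrite (last_nth x) size_takel //; case: k kt => [|k] kt //=.
  by rewrite nth_take.
by rewrite index_uniq.
Qed.

Lemma far_of_in x : x \in s -> far_of x \in s.
Proof.
move=> xs; rewrite /far_of; have := mem_last x (filter (r x) (rot (index x s) s)).
rewrite inE => /orP[/eqP->//|]; by rewrite mem_filter mem_rot => /andP[].
Qed.

Lemma far_ofP x y : x \in s -> y \in s -> (y \in range_oc s x (far_of x)) = r x y.
Proof. by move=> xs ys; rewrite range_far_of // mem_filter mem_rot ys andbT. Qed.

Lemma far_of_arrow x : x \in s -> r x (far_of x) || (far_of x == x).
Proof.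
move=> xs; rewrite /far_of; have := mem_last x (filter (r x) (rot (index x s) s)).
by rewrite inE mem_filter => /orP[->|/andP[->]] //; rewrite orbT.
Qed.

End FarOfRelation.

(** Each contig axiom comes from the round property. For consecutive [B -> C], the far neighbour of
    [B] is [C] or lies beyond [C] and so is a target of [C]; the closing axiom of a circular contig
    is the same argument for the last and first semiblocks. An arrow from the far neighbour of [B]
    back to [B] would break asymmetry. *)
Lemma contig_of_round (T : finType) (s : seq {set T}) (r : rel {set T}) (circ : bool) :
  s != [::] -> set0 \notin s -> pairwise (fun B W : {set T} => [disjoint B & W]) s ->
  round_on s (index^~ s) r ->
  (forall i, i.+1 < size s -> r (nth set0 s i) (nth set0 s i.+1)) ->
  (if circ then r (last set0 s) (head set0 s) else ~~ has (r (last set0 s)) s) ->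
  exists c : contig T, [/\ blocks c = s, circular c = circ &
    forall B W, contig_arrow c B W = [&& B \in s, W \in s & r B W]].
Proof.
move=> sN s0 ds rs steps ends; have us := disjoint_uniq s0 ds.
have far_in : {in s, forall B, far_of s r B \in s} by move=> B; apply: far_of_in.
have size_s : 0 < size s by rewrite lt0n size_eq0.
have ls : last set0 s \in s by rewrite -nth_last mem_nth // prednK.
have hs : head set0 s \in s by rewrite -nth0 mem_nth.
have step i : i.+1 < size s -> far_of s r (nth set0 s i)
    \in range_oc s (nth set0 s i) (far_of s r (nth set0 s i.+1)).
  move=> lt; have lt' := ltnW lt; have rB := steps i lt.
  have [Bs Cs] := (mem_nth set0 lt', mem_nth set0 lt).
  have [iB iC] : index (nth set0 s i) s = i /\ index (nth set0 s i.+1) s = i.+1.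
    by rewrite !index_uniq.
  set B := nth set0 s i in rB Bs iB *; set C := nth set0 s i.+1 in rB Cs iC *.
  have FB := far_in B Bs; have FC := far_in C Cs.
  have eqi X Y : X \in s -> Y \in s -> (index X s == index Y s) = (X == Y).
    by move=> Xs Ys; rewrite (inj_in_eq (@index_inj _ set0 s)).
  (* Otherwise the half-open range from [B] to the far neighbour of [C] would be empty; asymmetry
     against [B -> C] excludes this. *)
  have CB : far_of s r C != B.
    apply/eqP => E; have := far_of_arrow r Cs; rewrite E.
    rewrite (negPf (rs.1 _ _ Bs Cs rB)) /= => /eqP BC.
    by rewrite -BC iB in iC; move: iC; clear; lia.
  have := far_ofP us rs Bs Cs; rewrite rB.
  have := far_ofP us rs Cs FB.
  have : (far_of s r B == C) || r C (far_of s r B).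
    have [//|FBC] := eqVneq (far_of s r B) C.
    have := far_of_arrow r Bs => /orP[rF|/eqP FBB].
      have Fi : index (far_of s r B) s < size s by rewrite index_mem.
      suff cy : cyc (index B s) (index C s) (index (far_of s r B) s).
        by case/andP: (rs.2 _ _ _ Bs Cs FB cy rF).
      have : index (far_of s r B) s != index C s by rewrite eqi.
      have : index (far_of s r B) s != index B s.
        by rewrite eqi //; apply: contraTneq rF => ->; rewrite (round_irr rs).
      by rewrite iB iC /cyc; clear; lia.
    have := far_ofP us rs Bs Cs; rewrite rB FBB mem_range_oc // mem_range_cc // iB iC.
    by rewrite /in_arc; clear; lia.
  rewrite -!eqi // in CB *; rewrite !mem_range_oc // !mem_range_cc // -!eqi // iB iC.
  move: CB; rewrite iB; move: (r C (far_of s r B)) (index (far_of s r B) s) (index (far_of s r C) s) => b x y.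
  by rewrite /in_arc; clear; case: b; lia.
have lst : if circ then far_of s r (last set0 s) \in range_cc s (head set0 s) (far_of s r (head set0 s))
    else far_of s r (last set0 s) == last set0 s.
  case: ifP ends => [_ rl|_ /hasPn no].
    have Fl := far_in _ ls; have Fh := far_in _ hs.
    have [->|ne] := eqVneq (far_of s r (last set0 s)) (head set0 s).
      by rewrite mem_range_cc // -nth0 index_uniq // /in_arc.
    suff : r (head set0 s) (far_of s r (last set0 s)).
      by rewrite -(far_ofP us rs) // mem_range_oc // => /andP[].
    have /orP[rF|/eqP FE] := far_of_arrow r ls; last first.
      have := far_ofP us rs ls hs; rewrite rl FE mem_range_oc // mem_range_cc // => /andP[hl].
      have : index (head set0 s) s = index (last set0 s) s -> head set0 s = last set0 s.
        by apply: (index_inj set0).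
      rewrite /in_arc => H a; move: hl; rewrite H ?eqxx //; move: a; clear; lia.
    have Fi : index (far_of s r (last set0 s)) s < size s by rewrite index_mem.
    suff cy : cyc (index (last set0 s) s) (index (head set0 s) s) (index (far_of s r (last set0 s)) s).
      by case/andP: (rs.2 _ _ _ ls hs Fl cy rF).
    have : index (far_of s r (last set0 s)) s != index (head set0 s) s.
      by rewrite (inj_in_eq (@index_inj _ set0 s)).
    have : index (far_of s r (last set0 s)) s != index (last set0 s) s.
      by rewrite (inj_in_eq (@index_inj _ set0 s)) //; apply: contraTneq rF => ->; rewrite (round_irr rs).
    have [-> ->] : index (last set0 s) s = (size s).-1 /\ index (head set0 s) s = 0.
      by rewrite -nth_last -nth0 !index_uniq // prednK.
    have : index (far_of s r (last set0 s)) s < size s by [].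
    by rewrite /cyc; move: (index _ s) size_s; clear; lia.
  by have /orP[rF|//] := far_of_arrow r ls; have := no _ (far_in _ ls); rewrite rF.
have wrap : {in s, forall B, B \notin range_oc s (far_of s r B) (far_of s r (far_of s r B))}.
  move=> B Bs; rewrite far_ofP ?far_in //; have /orP[rF|/eqP E] := far_of_arrow r Bs.
    exact: rs.1 _ _ Bs (far_in _ Bs) rF.
  by rewrite E (round_irr rs).
exists (Contig sN s0 ds far_in step lst wrap); split=> // B W.
rewrite /contig_arrow /=; have [Bs|] := boolP (B \in s) => //=.
have [Ws|Ws] := boolP (W \in s); first exact: far_ofP.
by apply: contraNF Ws; rewrite mem_range_oc // => /andP[_]; apply: range_cc_sub.
Qed.

(** * Inherited positions, and cutting an ordering at its gaps *)

Section PosOrder.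
Variables (A : eqType) (pos : A -> nat).
Implicit Types s : seq A.

Definition pos_sorted s := sorted (fun x y => pos x < pos y) s.

Lemma pos_sorted_subseq s1 s2 : subseq s1 s2 -> pos_sorted s2 -> pos_sorted s1.
Proof. by apply: subseq_sorted => y x z; apply: ltn_trans. Qed.

Lemma pos_index s : pos_sorted s ->
  {in s &, forall x y, (index x s < index y s) = (pos x < pos y)}.
Proof.
move=> ss; have tr : transitive (fun x y => pos x < pos y) by move=> y x z; apply: ltn_trans.
have lt x y : x \in s -> y \in s -> index x s < index y s -> pos x < pos y.
  by move=> xs ys; apply: (sorted_ltn_index tr ss).
move=> x y xs ys; apply/idP/idP; first exact: lt.
apply: contraTT; rewrite -!leqNgt leq_eqVlt => /orP[/eqP|]; last by move/(lt _ _ ys xs)/ltnW.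
by move/(index_inj x ys xs) => ->.
Qed.

Lemma pos_sorted_uniq s : pos_sorted s -> uniq s.
Proof.
by apply: sorted_uniq => [y x z|x]; [apply: ltn_trans | rewrite ltnn].
Qed.

Lemma pos_cyc s : pos_sorted s -> {in s & &, forall x y z,
  cyc (index x s) (index y s) (index z s) = cyc (pos x) (pos y) (pos z)}.
Proof. by move=> ss x y z xs ys zs; rewrite /cyc !(pos_index ss). Qed.

Lemma round_on_index s (r : rel A) : pos_sorted s -> round_on s pos r ->
  round_on s (index^~ s) r.
Proof.
move=> ss [H1 H2]; split=> // x y z xs ys zs; rewrite (pos_cyc ss) //.
exact: H2.
Qed.

Lemma round_on_sub s s' (r : rel A) : {subset s' <= s} -> round_on s pos r -> round_on s' pos r.
Proof.
move=> ss [H1 H2]; split=> [x y /ss xs /ss ys|x y z /ss xs /ss ys /ss zs]; [exact: H1 | exact: H2].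
Qed.

End PosOrder.

Lemma sorted_index (A : eqType) (s : seq A) : uniq s -> pos_sorted (index^~ s) s.
Proof.
case: s => // x0 s0; set s := x0 :: s0 => us.
by apply/(sortedP x0) => i lt; rewrite !index_uniq // ltnW.
Qed.

(** The shortest initial run that ends at a gap is split off as a linear contig, and induction
    treats the rest. No arrow crosses the gap: by betweenness it would join the two elements next to
    the gap. *)
Lemma linear_contigs (T : finType) (s : seq {set T}) (pos : {set T} -> nat) (r : rel {set T}) :
  set0 \notin s -> pairwise (fun B W : {set T} => [disjoint B & W]) s ->
  pos_sorted pos s -> round_on s pos r ->
  {in s &, forall B W, r B W -> pos B < pos W} ->
  exists cs : seq (contig T), [/\ flatten (map (@blocks T) cs) = s,
    all (fun c => ~~ circular c) cs &
    forall B W, has (fun c => contig_arrow c B W) cs = [&& B \in s, W \in s & r B W]].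
Proof.
have [n] := ubnP (size s); elim: n s => // n IH s; rewrite ltnS => le_n s0 ds ss rs L1.
case: (posnP (size s)) => [/size0nil->|size_s]; first by exists [::]; split.
have us := pos_sorted_uniq ss.
(* The ordering can be cut before position [k]. The least such [k] has all earlier consecutive pairs
   joined, and [size s] always qualifies. *)
pose run k := (0 < k) && ((k >= size s) || ~~ r (nth set0 s k.-1) (nth set0 s k)).
have exk : exists k, run k by exists (size s); rewrite /run size_s leqnn.
case: (ex_minnP exk) => k /andP[k0 runk] mink.
have kle : k <= size s by apply: mink; rewrite /run size_s leqnn.
set u := take k s; set w := drop k s.
have su : size u = k by rewrite size_takel.
have sE : s = u ++ w by rewrite cat_take_drop.
have [us_ ws_] : {subset u <= s} /\ {subset w <= s} by split=> B; [apply: mem_take | apply: mem_drop].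
have steps i : i.+1 < k -> r (nth set0 s i) (nth set0 s i.+1).
  move=> lt; apply: contraLR lt => nr; rewrite -leqNgt; apply: mink.
  by rewrite /run /= nr orbT.
have ui B : B \in u -> index B s < k by move=> Bu; rewrite -in_take // us_.
have wi B : B \in w -> k <= index B s.
  move=> Bw; rewrite leqNgt -in_take ?ws_ //; apply/negP => Bu.
  by move: us; rewrite sE cat_uniq => /and3P[_ /hasPn/(_ B Bw)/negP].
have apart B W : B \in u -> W \in w -> ~~ r B W && ~~ r W B.
  move=> Bu Wu; have [Bs Ws] := (us_ _ Bu, ws_ _ Wu).
  have iBW : index B s < index W s := leq_trans (ui _ Bu) (wi _ Wu).
  apply/andP; split; apply/negP => rBW; last first.
    by have := L1 _ _ Ws Bs rBW; rewrite -(pos_index ss) // ltnNge (ltnW iBW).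
  have klt : k < size s by apply: leq_ltn_trans (wi _ Wu) _; rewrite index_mem.
  have := runk; rewrite leqNgt klt /= => /negP[].
  have klt' : k.-1 < size s by rewrite (leq_ltn_trans (leq_pred _)).
  have [ks ks'] := (mem_nth set0 klt, mem_nth set0 klt').
  have [ik ik'] : index (nth set0 s k) s = k /\ index (nth set0 s k.-1) s = k.-1.
    by rewrite !index_uniq.
  (* The arrow [B -> W] is shortened from the left to start at position [k.-1], and then from the
     right to end at position [k]. *)
  have rk' : r (nth set0 s k.-1) W.
    have [<-//|ne] := eqVneq B (nth set0 s k.-1).
    have ne' : index B s != k.-1.
      by rewrite -ik'; apply: contraNneq ne => /(index_inj set0 Bs ks') ->.
    suff cy : cyc (pos B) (pos (nth set0 s k.-1)) (pos W).
      by case/andP: (rs.2 _ _ _ Bs ks' Ws cy rBW).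
    rewrite -(pos_cyc ss) // ik' /cyc; move: (ui _ Bu) (wi _ Wu) ne'.
    by move: (index B s) (index W s) k0; clear; lia.
  have [->//|ne] := eqVneq (nth set0 s k) W.
  have ne' : index W s != k.
    by rewrite -ik; apply: contraNneq ne => /(index_inj set0 Ws ks) ->.
  suff cy : cyc (pos (nth set0 s k.-1)) (pos (nth set0 s k)) (pos W).
    by case/andP: (rs.2 _ _ _ ks' ks Ws cy rk').
  rewrite -(pos_cyc ss) // ik ik' /cyc; move: (wi _ Wu) ne'.
  by move: (index W s) k0; clear; lia.
have ssu : pos_sorted pos u by apply: pos_sorted_subseq ss; apply: take_subseq.
have ssw : pos_sorted pos w by apply: pos_sorted_subseq ss; apply: drop_subseq.
have dsuw := ds; rewrite sE pairwise_cat in dsuw; case/and3P: dsuw => _ du dw.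
have s0uw := s0; rewrite sE mem_cat negb_or in s0uw; case/andP: s0uw => s0u s0w.
have uN : u != [::] by rewrite -size_eq0 su -lt0n.
have [c [cE clin car]] : exists c : contig T, [/\ blocks c = u, circular c = false &
    forall B W, contig_arrow c B W = [&& B \in u, W \in u & r B W]].
  apply: contig_of_round => //.
  - by apply: (round_on_index ssu); apply: round_on_sub rs.
  - by move=> i; rewrite su => lt; rewrite !nth_take ?(ltnW lt) //; apply: steps.
  apply/hasPn => B Bu; apply/negP => rB.
  have lu : last set0 u \in u by rewrite -nth_last mem_nth // su prednK.
  have := L1 _ _ (us_ _ lu) (us_ _ Bu) rB; rewrite -(pos_index ssu) //.
  rewrite -nth_last index_uniq ?su ?prednK ?(pos_sorted_uniq ssu) //.
  by have := Bu; rewrite -index_mem su; case: (k) k0 => // j _; rewrite ltnS => ?; rewrite ltnNge => /negP.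
have szw : size w < n by rewrite size_drop (leq_trans _ le_n) // ltn_subrL k0.
have L1w : {in w &, forall B W, r B W -> pos B < pos W}.
  by move=> B W /ws_ Bs /ws_ Ws; apply: L1.
have [cs [csE cslin csar]] := IH w szw s0w dw ssw (round_on_sub ws_ rs) L1w.
exists (c :: cs); split=> [|/=|B W /=]; first by rewrite /= cE csE.
  by rewrite clin.
have memE X : (X \in s) = (X \in u) || (X \in w) by rewrite sE mem_cat.
rewrite car csar !memE.
have exc X : X \in u -> X \in w -> False.
  by move=> Xu Xw; have := ui _ Xu; rewrite ltnNge wi.
move: (exc B) (exc W) (apart B W) (apart W B).
case: (B \in u); case: (B \in w); case: (W \in u); case: (W \in w) => e1 e2 a1 a2 //=;
  rewrite ?orbF //; try by [case: (e1 isT isT) | case: (e2 isT isT)].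
- by have /andP[/negPf->] := a1 isT isT.
- by have /andP[_ /negPf->] := a2 isT isT.
Qed.

(** Inside a contig consecutive semiblocks are joined. After the last semiblock of a contig, the
    next one lies in another contig or, after wrapping, not later in the same one, and no arrow
    leads there. *)
Lemma linear_near_R (T : finType) (Phi : round_rep T) (B : {set T}) :
  all (fun c => ~~ circular c) (contigs Phi) -> B \in semiblocks Phi ->
  near_R Phi B = if arrow Phi B (next (semiblocks Phi) B)
                 then Some (next (semiblocks Phi) B) else None.
Proof.
move=> lin BP; have /semiblocksP[c cl Bc] := BP; have lc := all_linear lin cl.
have Bi := index_blocks Bc.
rewrite (near_RE cl Bc) (arrow_inl _ cl Bc).
case: ifP => [BN|BN]; last first.
  apply/(contig_R_none Bc); split=> //; apply/eqP; move: BN; apply: contraFT => lt.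
  have {}lt : (index B (blocks c)).+1 < size (blocks c) by rewrite ltn_neqAle lt.
  have := semiblocks_uniq Phi; have [s1 [s2 E]] := contigs_split cl; rewrite E => us.
  have := near_arrow lt; rewrite nth_index //.
  have := us; rewrite cat_uniq => /and3P[_ /hasPn n1 _].
  have iE w : w \in blocks c -> index w (s1 ++ blocks c ++ s2) = size s1 + index w (blocks c).
    move=> wc; rewrite !index_cat wc (negPf (n1 w _)) // mem_cat wc //.
  set X := nth _ _ _; have Xc : X \in blocks c by apply: mem_nth.
  have Xi : index X (blocks c) = (index B (blocks c)).+1 by rewrite index_uniq ?blocks_uniq.
  suff -> : X = next (s1 ++ blocks c ++ s2) B by [].
  have Bs : B \in s1 ++ blocks c ++ s2 by rewrite -E.
  apply: (@index_inj _ set0 (s1 ++ blocks c ++ s2)); rewrite ?mem_next ?mem_cat ?Xc ?Bc ?orbT //.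
  rewrite /= index_next // !iE // Xi addnS ifT //.
  by rewrite !size_cat -addnS ltn_add2l (leq_trans lt) ?leq_addr.
have /andP[_ Nc] := arrow_blocks BN.
apply/contig_R_some; split=> //; left.
have lt := linear_arrow lc BN.
have := semiblocks_uniq Phi; have [s1 [s2 E]] := contigs_split cl; rewrite E in Nc lt *; move=> us.
have := us; rewrite cat_uniq => /and3P[_ /hasPn n1 _].
have iE w : w \in blocks c -> index w (s1 ++ blocks c ++ s2) = size s1 + index w (blocks c).
  move=> wc; rewrite !index_cat wc (negPf (n1 w _)) // mem_cat wc //.
have Bs : B \in s1 ++ blocks c ++ s2 by rewrite -E.
have := index_next us Bs; rewrite !iE //; case: ifP => _; move: lt; clear; lia.
Qed.

(** The third conclusion expresses near neighbours through the cyclic order and the arrows, in the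
    same way for a circular contig and for a cut ordering. Thus one representation can be checked to
    be a deletion of another without knowing where either is cut. *)
Lemma round_rep_of_round (T : finType) (s : seq {set T}) (pos : {set T} -> nat)
    (r : rel {set T}) :
  set0 \notin s -> pairwise (fun B W : {set T} => [disjoint B & W]) s ->
  pos_sorted pos s -> round_on s pos r ->
  exists Phi : round_rep T, [/\ semiblocks Phi =i s,
    forall B W, arrow Phi B W = [&& B \in s, W \in s & r B W] &
    {in s, forall B, near_R Phi B = if r B (next s B) then Some (next s B) else None}].
Proof.
move=> s0 ds ss rs; have us := pos_sorted_uniq ss; have ri := round_on_index ss rs.
have idx B : B \in s -> index B s < size s by rewrite index_mem.
have nexti B : B \in s -> index (next s B) s = if (index B s).+1 < size s then (index B s).+1 else 0.
  exact: index_next.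
have [/andP[sN /allP allr]|] := boolP ((s != [::]) && all (fun B => r B (next s B)) s).
  have size_s : 0 < size s by rewrite lt0n size_eq0.
  have nx i : i < size s -> next s (nth set0 s i) = nth set0 s (if i.+1 < size s then i.+1 else 0).
    move=> lt; have ms := mem_nth set0 lt.
    apply: (@index_inj _ set0 s); rewrite ?mem_next ?mem_nth //; first by case: ifP.
    by rewrite nexti // !index_uniq //; case: ifP.
  have [c [cE cc car]] : exists c : contig T, [/\ blocks c = s, circular c = true &
      forall B W, contig_arrow c B W = [&& B \in s, W \in s & r B W]].
    apply: contig_of_round => // [i lt|].
      by have := allr _ (mem_nth set0 (ltnW lt)); rewrite nx ?lt // ltnW.
    have lt : (size s).-1 < size s by rewrite prednK.
    by have := allr _ (mem_nth set0 lt); rewrite nx // prednK // ltnn nth0 nth_last.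
  have disj : pairwise (fun c d : contig T => [disjoint contig_vset c & contig_vset d]) [:: c] by [].
  have kind : (size [:: c] == 1) || all (fun c => ~~ circular c) [:: c] by [].
  pose Phi := RoundRep disj kind; have cl : List.In c (contigs Phi) by left.
  exists Phi; split=> [B|B W|B Bs]; first by rewrite /semiblocks /= cats0 cE.
    by rewrite /arrow /= orbF car.
  rewrite (near_RE cl) ?cE // allr //; apply/contig_R_some; rewrite cE mem_next; split=> //.
  by rewrite nexti // cc; case: ltnP => lt; [left | right; split=> //; apply/eqP; rewrite eqn_leq lt idx].
move=> gap.
(* The ordering is rotated to begin just after a gap between some [B] and [next s B]. An arrow going
   backwards there would pass over the gap, and betweenness would shorten it to an arrow from [B] to
   [next s B]. *)
have [s' [ks sE L1]] : exists s', [/\ exists k, s' = rot k s, round_on s' (index^~ s') r &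
   {in s' &, forall B W, r B W -> index B s' < index W s'}].
  move: gap; rewrite negb_and negbK => /orP[/eqP->|/allPn[B Bs nrB]].
    by exists [::]; split=> //; exists 0.
  pose k := (index B s).+1; exists (rot k s).
  have kle : k <= size s := idx _ Bs.
  have rr : round_on (rot k s) (index^~ (rot k s)) r.
    split=> [x y|x y z]; rewrite !mem_rot; first exact: rs.1.
    move=> xs ys zs cy; apply: ri.2 => //; move: cy; rewrite !index_rot // /cyc.
    have [[xi yi] zi] := (idx _ xs, idx _ ys, idx _ zs); move: kle xi yi zi.
    move: (index x s) (index y s) (index z s) (size s) => a b e n; move: (k) => k'; clear.
    by case: (leqP k' a); case: (leqP k' b); case: (leqP k' e); lia.
  split=> //; first by exists k.
  move=> x y; rewrite !mem_rot => xs ys rxy; rewrite ltnNge; apply/negP => le.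
  have Ns : next s B \in s by rewrite mem_next.
  case/negP: nrB.
  have iB : index B (rot k s) = (size s).-1.
    by rewrite index_rot // leqNgt ltnSn /=; move: kle; rewrite /k; move: (index B s) (size s); clear; lia.
  have iN : index (next s B) (rot k s) = 0.
    rewrite index_rot // nexti // -/k; move: kle; rewrite leq_eqVlt => /orP[/eqP->|->].
      by rewrite ltnn; case: ifP => _; rewrite ?sub0n ?subnn.
    by rewrite leqnn subnn.
  have eqi a b : a \in s -> b \in s -> (index a (rot k s) == index b (rot k s)) = (a == b).
    by move=> as_ bs; rewrite (inj_in_eq (@index_inj _ set0 (rot k s))) ?mem_rot.
  have xy : index x (rot k s) != index y (rot k s).
    by rewrite eqi //; apply: contraTneq rxy => ->; rewrite (round_irr ri).
  have xlt : index x (rot k s) < size s by rewrite -(size_rot k) index_mem mem_rot.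
  have rBy : r B y.
    have [<-//|ne] := eqVneq x B.
    have := rr.2 x B y; rewrite !mem_rot => /(_ xs Bs ys) H.
    suff cy : cyc (index x (rot k s)) (index B (rot k s)) (index y (rot k s)) by case/andP: (H cy rxy).
    move: ne; rewrite -eqi // iB /cyc; move: xlt xy le.
    by move: (index x _) (index y _) (size s); clear; lia.
  have [->//|ne] := eqVneq (next s B) y.
  have := rr.2 B (next s B) y; rewrite !mem_rot => /(_ Bs Ns ys) H.
  suff cy : cyc (index B (rot k s)) (index (next s B) (rot k s)) (index y (rot k s)) by case/andP: (H cy rBy).
  move: ne; rewrite -eqi // iB iN /cyc; move: xlt xy le.
  by move: (index x _) (index y _) (size s); clear; lia.
case: ks => k kE; have ms B : (B \in s') = (B \in s) by rewrite kE mem_rot.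
have us' : uniq s' by rewrite kE rot_uniq.
have s0' : set0 \notin s' by rewrite ms.
have ds' : pairwise (fun B W : {set T} => [disjoint B & W]) s'.
  have sym : symmetric (fun B W : {set T} => [disjoint B & W]).
    by move=> B W; rewrite disjoint_sym.
  move: ds; rewrite kE /rot -{1}(cat_take_drop k s) !pairwise_cat allrelC.
  case/and3P=> dtd -> ->; rewrite !andbT; apply: sub_allrel dtd => B W.
  by rewrite disjoint_sym.
have [cs [csE cslin csar]] := linear_contigs s0' ds' (sorted_index us') sE L1.
have disj : pairwise (fun c d : contig T => [disjoint contig_vset c & contig_vset d]) cs.
  have vsetE (c : contig T) x : (x \in contig_vset c) = has (fun B : {set T} => x \in B) (blocks c).
    by rewrite /contig_vset; elim: (blocks c) => [|B l IH]; rewrite ?big_nil ?big_cons inE //= IH.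
  move: ds'; rewrite -csE; elim: cs {csE cslin csar} => //= c l IH.
  rewrite pairwise_cat => /and3P[cl _ /IH->]; rewrite andbT.
  elim: l cl {IH} => //= d l IH; rewrite allrel_catr => /andP[/allrelP cd /IH->].
  rewrite andbT; apply/pred0P => x /=; rewrite !vsetE; apply/negP.
  case/andP=> /hasP[B Bc xB] /hasP[W Wd xW].
  by have /disjointFr/(_ xB) := cd _ _ Bc Wd; rewrite xW.
have kind : (size cs == 1) || all (fun c => ~~ circular c) cs by rewrite cslin orbT.
exists (RoundRep disj kind); split=> [B|B W|B Bs].
- by rewrite /semiblocks /= csE ms.
- by rewrite /arrow /= csar !ms.
rewrite linear_near_R //; last by rewrite /semiblocks /= csE ms.
rewrite (_ : semiblocks _ = rot k s); last by rewrite /semiblocks /= csE kE.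
by rewrite next_rot // /arrow /= csar !ms Bs mem_next Bs.
Qed.

(** * Receptions and vertex orderings *)

Lemma same_graph_isomorphic (T : finType) (G K : sgraph T) :
  same_graph G K -> isomorphic G K.
Proof.
case=> EV EE.
have GK (x : {x | x \in vset G}) : val x \in vset K by rewrite -EV (valP x).
have KG (x : {x | x \in vset K}) : val x \in vset G by rewrite EV (valP x).
exists (fun x => exist _ (val x) (GK x)) => [|x y]; last by rewrite /= EE.
by exists (fun x => exist _ (val x) (KG x)) => x; apply: val_inj.
Qed.

Section RoundRepGraph.
Variables (T : finType) (Phi : round_rep T).
Implicit Types (B W : {set T}) (x y : T).

Lemma rr_vsetP x : reflect (exists2 B, B \in semiblocks Phi & x \in B) (x \in rr_vset Phi).
Proof.
apply: (iffP idP) => [|[B Bs xB]]; last by rewrite /rr_vset (big_rem B) //= inE xB.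
rewrite /rr_vset; elim: (semiblocks Phi) => [|B s IH]; rewrite ?big_nil ?inE // big_cons inE.
by case/orP=> [xB|/IH[W Ws xW]]; [exists B; rewrite ?inE ?eqxx | exists W; rewrite ?inE ?Ws ?orbT].
Qed.

Lemma rr_edgeE B W x y : B \in semiblocks Phi -> W \in semiblocks Phi -> x \in B -> y \in W ->
  rr_edge Phi x y = (x != y) && [|| B == W, arrow Phi B W | arrow Phi W B].
Proof.
move=> Bs Ws xB yW; rewrite /rr_edge; congr (_ && _); apply/hasP/idP => [[B' B's /hasP[W' W's]]|H].
  case/and3P=> xB' yW' H; have := semiblock_eq B's Bs xB' xB; have := semiblock_eq W's Ws yW' yW.
  by move=> <- <-.
by exists B => //; apply/hasP; exists W => //; rewrite xB yW.
Qed.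

End RoundRepGraph.

Section ReceptionGraph.
Variables (T : finType) (H : sgraph T) (v : T).
Implicit Types (Phi Psi : round_rep T) (B W Bl Br : {set T}) (x y : T).

Lemma mem_bigcup_seq (s : seq {set T}) x :
  reflect (exists2 B, B \in s & x \in B) (x \in \bigcup_(B <- s) B).
Proof.
elim: s => [|B s IH]; rewrite ?big_nil ?inE; first by constructor; case.
rewrite big_cons inE; apply: (iffP orP) => [[xB|/IH[W Ws xW]]|[W]].
- by exists B; rewrite ?inE ?eqxx.
- by exists W; rewrite ?inE ?Ws ?orbT.
- by rewrite inE => /orP[/eqP->|Ws xW]; [left | right; apply/IH; exists W].
Qed.

Lemma mem_rr_range_reception Phi Psi Bl Br y : reception v Phi Bl Br Psi -> y != v ->
  (y \in \bigcup_(B <- rr_range Phi Bl Br) B) = rr_edge Psi v y.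
Proof.
case=> VP del [BlP BrP] BlE BrE yv.
have rangeE := rr_range_reception del VP BlP BrP BlE BrE.
apply/mem_bigcup_seq/idP => [[W]|].
  rewrite rangeE => /andP[WP ar] yW; move: WP; rewrite (mem_deletion del) => /andP[WV WP].
  rewrite (rr_edgeE VP WP _ yW) ?inE // eq_sym yv /=.
  by case/orP: ar => ->; rewrite ?orbT.
move=> vy; have /rr_vsetP[W WP yW] : y \in rr_vset Psi.
  by apply: (@rr_edge_vset _ _ _ v); rewrite rr_edge_sym.
exists W => //; rewrite rangeE (mem_deletion del) WP.
have WV : W != [set v] by apply: contraTneq yW => ->; rewrite inE.
move: vy; rewrite (rr_edgeE VP WP _ yW) ?inE // eq_sym (negPf WV) [_ == W]eq_sym (negPf WV) /=.
by rewrite orbC => /andP[].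
Qed.

Lemma reception_represents Phi Psi Bl Br : v \in vset H ->
  represents Phi (remove_vertex H v) ->
  nbh H v = \bigcup_(B <- rr_range Phi Bl Br) B ->
  reception v Phi Bl Br Psi -> represents Psi H.
Proof.
move=> vH [/= PhiV PhiE] nH rec; have [VP del _ _ _] := rec.
have PsiV : rr_vset Psi = vset H.
  apply/setP => x; have [->|xv] := eqVneq x v.
    by rewrite vH; apply/rr_vsetP; exists [set v]; rewrite ?inE.
  have -> : (x \in vset H) = (x \in rr_vset Phi) by rewrite PhiV !inE xv.
  apply/rr_vsetP/rr_vsetP => -[B BP xB]; exists B => //; move: BP; rewrite (mem_deletion del).
    by move=> ->; rewrite andbT; apply: contraTneq xB => ->; rewrite inE.
  by case/andP.
have Hv y : rr_edge Psi v y = edge H v y.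
  have [->|yv] := eqVneq y v; first by rewrite rr_edge_irr edge_irr.
  by rewrite -(mem_rr_range_reception rec yv) -nH inE.
split=> // x y /=; have [->|xv] := eqVneq x v; first exact: Hv.
have [->|yv] := eqVneq y v; first by rewrite rr_edge_sym Hv edge_sym.
have out : (x \notin rr_vset Psi) || (y \notin rr_vset Psi) -> rr_edge Psi x y = edge H x y.
  move=> o; transitivity false; last symmetry; apply/negbTE; apply: contraTN o => xy.
    by rewrite negb_or !negbK (rr_edge_vset xy) -[y \in _]/(y \in rr_vset Psi) (@rr_edge_vset _ _ y x) // rr_edge_sym.
  by rewrite negb_or !negbK PsiV (edge_vset xy) (@edge_vset _ _ y x) // edge_sym.
have [/rr_vsetP[B BP xB]|xN] := boolP (x \in rr_vset Psi); last by apply: out; rewrite xN.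
have [/rr_vsetP[W WP yW]|yN] := boolP (y \in rr_vset Psi); last by apply: out; rewrite yN orbT.
have BP' : B \in semiblocks Phi.
  by rewrite (mem_deletion del) BP andbT; apply: contraTneq xB => ->; rewrite inE.
have WP' : W \in semiblocks Phi.
  by rewrite (mem_deletion del) WP andbT; apply: contraTneq yW => ->; rewrite inE.
have := PhiE x y; rewrite /= /remove_edge xv yv /= => <-.
rewrite (rr_edgeE BP WP xB yW) (rr_edgeE BP' WP' xB yW).
by rewrite !(arrow_deletion del).
Qed.

End ReceptionGraph.

(** * Vertex orderings of PCA graphs *)

Lemma lex_ltn k a b i j : i < k -> j < k ->
  (a * k + i < b * k + j) = (a < b) || (a == b) && (i < j).
Proof.
move=> ik jk; case: (ltngtP a b) => [lt|lt|->] /=; last by rewrite ltn_add2l.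
  by rewrite (@leq_trans (a.+1 * k)) // ?mulSn ?[k + _]addnC ?ltn_add2l // (leq_trans _ (leq_addr _ _)) // -mulSnr leq_mul2r lt orbT.
apply/negbTE; rewrite -leqNgt (@leq_trans (b.+1 * k)) //; first by rewrite mulSnr leq_add2l ltnW.
by rewrite (leq_trans _ (leq_addr _ _)) // leq_mul2r lt orbT.
Qed.

(** Vertices are ordered lexicographically by semiblock and rank, and those of one semiblock are
    joined in the direction of increasing rank. Betweenness holds because a vertex between [x] and
    [z] lies in the semiblock of [x], in that of [z], or in one strictly between them. *)
Lemma PCA_round (T : finType) (H : sgraph T) : PCA H ->
  exists (pos : T -> nat) (r : rel T), [/\ injective pos,
    forall x y, edge H x y = r x y || r y x & round_on (enum (vset H)) pos r].
Proof.
case=> U [Phi [f [g fK gK] fE]].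
have f_inj : injective f by apply: can_inj fK.
(* Outside [vset H] the image is [None] and the semiblock [set0]; the ranks keep [pos] injective
   there as well. *)
pose img (x : T) : option U := omap (fun u => val (f u)) (insub x).
pose blk (x : T) : {set U} :=
  if img x is Some y then odflt set0 [pick B | (B \in semiblocks Phi) && (y \in B)] else set0.
have blkP (x : {x | x \in vset H}) : blk (val x) \in semiblocks Phi /\ val (f x) \in blk (val x).
  rewrite /blk /img valK /=; case: pickP => [B /andP[]//|none].
  by have /rr_vsetP[B Bs xB] := valP (f x); have := none B; rewrite Bs xB.
have blk_in x : x \in vset H -> blk x \in semiblocks Phi.
  by move=> xH; have [] := blkP (Sub x xH).
pose pos x := index (blk x) (semiblocks Phi) * #|T| + enum_rank x.
pose r x y := [&& x \in vset H, y \in vset H &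
  arrow Phi (blk x) (blk y) || (blk x == blk y) && (enum_rank x < enum_rank y)].
have posE x y : (pos x < pos y) = (index (blk x) (semiblocks Phi) < index (blk y) (semiblocks Phi)) ||
    (index (blk x) (semiblocks Phi) == index (blk y) (semiblocks Phi)) && (enum_rank x < enum_rank y).
  exact: lex_ltn.
have rk x y : (enum_rank x == enum_rank y :> nat) = (x == y).
  by rewrite (inj_eq val_inj) (inj_eq enum_rank_inj).
have [asym C2] := round_rep_round Phi.
have irr B : B \in semiblocks Phi -> arrow Phi B B = false.
  by move=> Bs; apply/negP => a; have := asym _ _ Bs Bs a; rewrite a.
have beq x y : x \in vset H -> y \in vset H ->
    (index (blk x) (semiblocks Phi) == index (blk y) (semiblocks Phi)) = (blk x == blk y).
  by move=> xH yH; rewrite (inj_in_eq (@index_inj _ set0 _)) ?blk_in.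
exists pos, r; split.
- move=> x y E; apply/eqP; rewrite -rk; have := posE x y; have := posE y x; rewrite E ltnn.
  by move: (enum_rank x : nat) (enum_rank y : nat) (index _ _) (index _ _); clear; lia.
- move=> x y; have [xH|xN] := boolP (x \in vset H); last first.
    by rewrite /r (negPf xN) /= andbF; apply/negP => /edge_vset; rewrite (negPf xN).
  have [yH|yN] := boolP (y \in vset H); last first.
    by rewrite /r (negPf yN) /= andbF; apply/negP; rewrite edge_sym => /edge_vset; rewrite (negPf yN).
  have := fE (Sub x xH) (Sub y yH); rewrite !SubK => <-.
  have [Bx fx] := blkP (Sub x xH); have [By fy] := blkP (Sub y yH); rewrite !SubK in Bx fx By fy.
  rewrite /= (rr_edgeE Bx By fx fy) (inj_eq val_inj) (inj_eq f_inj) -(inj_eq val_inj) !SubK.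
  rewrite /r xH yH /= [blk y == _]eq_sym; have [E|ne] := eqVneq (blk x) (blk y).
    rewrite E !irr ?blk_in //= andbT -rk; clear; move: (enum_rank x : nat) (enum_rank y : nat); lia.
  rewrite /= !orbF; have [E|//] := eqVneq x y; by rewrite E eqxx in ne.
split=> [x y|x y z]; rewrite !mem_enum.
  move=> xH yH; rewrite /r xH yH /= => /orP[a|/andP[/eqP-> lt]].
    rewrite negb_or asym ?blk_in //=; apply: contraTN a => /andP[/eqP-> _].
    by rewrite irr ?blk_in.
  by rewrite irr ?blk_in //= eqxx -leqNgt ltnW.
move=> xH yH zH; rewrite /cyc !posE /r xH yH zH /=.
have [bx by_ bz] := And3 (blk_in _ xH) (blk_in _ yH) (blk_in _ zH).
have C := C2 _ _ _ bx by_ bz; rewrite /cyc in C.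
have [bxy byz bxz] := And3 (beq _ _ xH yH) (beq _ _ yH zH) (beq _ _ xH zH).
move=> cy /orP[a|/andP[/eqP E lt]]; last first.
  have [exy xy yz] : [/\ blk x == blk y, enum_rank x < enum_rank y & enum_rank y < enum_rank z].
    rewrite -bxy; move: cy lt; rewrite E.
    move: (enum_rank x : nat) (enum_rank y : nat) (enum_rank z : nat) => i j k.
    by move: (index _ _) (index _ _); clear=> m n cy lt; split; move: cy lt; lia.
  by rewrite exy -E [blk y == _]eq_sym exy xy yz !orbT.
have nxz : blk x != blk z by apply: contraTneq a => ->; rewrite irr.
have [exy|nxy] := eqVneq (blk x) (blk y).
  rewrite -exy a /= andbT; apply/orP; right; move: cy nxz; rewrite -bxz -exy.
  move: (enum_rank x : nat) (enum_rank y : nat) (enum_rank z : nat) => i j k.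
  by move: (index _ _) (index _ _); clear; lia.
have [eyz|nyz] := eqVneq (blk y) (blk z).
  rewrite eyz a /=; apply/orP; right; move: cy nxz; rewrite -bxz eyz.
  move: (enum_rank x : nat) (enum_rank y : nat) (enum_rank z : nat) => i j k.
  by move: (index _ _) (index _ _); clear; lia.
rewrite !orbF; apply: C => //; move: cy nxz nxy nyz; rewrite -bxz -bxy -byz.
move: (enum_rank x : nat) (enum_rank y : nat) (enum_rank z : nat) => i j k.
by move: (index _ _) (index _ _) (index _ _); clear; lia.
Qed.

(** If [u] lies between [x] and [y], it is joined to both [w] and [y]. Otherwise it lies between [y]
    and [x], and betweenness turns [u -> y] into [u -> w] and [w -> u] into [y -> u]. The converses
    pass through [u -> x] and [x -> u], which is where the two inclusions of [clones] enter. *)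
Lemma clones_between (A : eqType) (s : seq A) (pos : A -> nat) (r : rel A) x y w :
  {in s &, injective pos} -> round_on s pos r -> x \in s -> y \in s -> w \in s ->
  clones s r x y -> cyc (pos x) (pos w) (pos y) ->
  {in s, forall u, [|| u == w, r u w | r w u] = [|| u == y, r u y | r y u]}.
Proof.
move=> pos_inj [asym C2] xs ys ws [rxy inxy outxy _] cxwy u us.
have /andP[rxw rwy] := C2 _ _ _ xs ws ys cxwy rxy.
have [->|uw] := eqVneq u w; first by rewrite rwy !orbT.
have [->|uy] := eqVneq u y; first by rewrite rwy !orbT.
have [->|ux] := eqVneq u x; first by rewrite rxw rxy.
have C a b c as_ bs cs h := C2 a b c as_ bs cs h.
have [puw puy pux] : [/\ pos u != pos w, pos u != pos y & pos u != pos x].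
  by rewrite !(inj_in_eq pos_inj).
have : [|| cyc (pos x) (pos u) (pos w), cyc (pos w) (pos u) (pos y) | cyc (pos y) (pos u) (pos x)].
  move: cxwy puw puy pux; rewrite /cyc.
  by move: (pos x) (pos y) (pos w) (pos u); clear; lia.
case/or3P=> cu.
- have /andP[_ ->] := C _ _ _ xs us ws cu rxw.
  have cu' : cyc (pos x) (pos u) (pos y).
    by move: cu cxwy; rewrite /cyc; move: (pos x) (pos y) (pos w) (pos u); clear; lia.
  by have /andP[_ ->] := C _ _ _ xs us ys cu' rxy; rewrite !orbT.
- by have /andP[-> ->] := C _ _ _ ws us ys cu rwy; rewrite !orbT.
have [c1 c2 c3 c4] : [/\ cyc (pos u) (pos x) (pos w), cyc (pos w) (pos y) (pos u),
    cyc (pos u) (pos w) (pos y) & cyc (pos x) (pos w) (pos u)].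
  by move: cu cxwy; rewrite /cyc; move: (pos x) (pos y) (pos w) (pos u) => a b c d;
     clear; split; lia.
rewrite /=; apply/idP/idP => /orP[h|h]; apply/orP.
- by have /andP[/(inxy _ us)] := C _ _ _ us xs ws c1 h; left.
- by have /andP[_] := C _ _ _ ws ys us c2 h; right.
- by have /andP[] := C _ _ _ us ws ys c3 h; left.
- by have /andP[_] := C _ _ _ xs ws us c4 (outxy _ us h); right.
Qed.

Lemma pairwise_uniq_in (A : eqType) (e : rel A) (s : seq A) : uniq s ->
  {in s &, forall x y, x != y -> e x y} -> pairwise e s.
Proof.
elim: s => //= x s IH /andP[xs us] H; apply/andP; split.
  apply/allP => y ys; apply: H; rewrite ?inE ?eqxx ?ys ?orbT //.
  by apply: contraNneq xs => ->.
by apply: IH => // y z ys zs; apply: H; rewrite inE ?ys ?zs orbT.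
Qed.

Lemma next_filter (A : eqType) (s : seq A) a b : uniq s -> a \in s -> b \in s -> b != a ->
  next [seq x <- s | x != a] b = if next s b == a then next s a else next s b.
Proof.
move=> us as_ bs ba.
have [t rE] : exists t, rot (index a s) s = a :: t by eexists; apply: rot_index.
have ut : uniq (a :: t) by rewrite -rE rot_uniq.
have fE : next [seq x <- s | x != a] b = next t b.
  have -> : t = [seq x <- rot (index a s) s | x != a].
    rewrite rE /= eqxx /=; symmetry; apply/all_filterP/allP => x xt.
    by apply: contraTneq xt => ->; case/andP: ut.
  have sE := cat_take_drop (index a s) s; rewrite -{1}sE /rot !filter_cat.
  rewrite -[X in next X b](rotK (size [seq x <- take (index a s) s | x != a])) rot_size_cat.
  by rewrite next_rotr // -filter_cat filter_uniq // uniq_catC sE.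
rewrite fE -!(next_rot (index a s) us) rE.
have bt : b \in t by have := bs; rewrite -(mem_rot (index a s)) rE inE (negPf ba).
have bat : b \in a :: t by rewrite inE bt orbT.
have aat : a \in a :: t by rewrite inE eqxx.
have ut' : uniq t by case/andP: ut.
have ba' := bt; rewrite -index_mem in ba'.
have idx x : x \in t -> index x (a :: t) = (index x t).+1.
  by move=> xt /=; case: eqVneq => // E; move: ut; rewrite E /= xt.
have nb := index_next ut bat; have na := index_next ut aat; have nt := index_next ut' bt.
rewrite (idx b bt) in nb; rewrite index_head in na.
have ia x : x \in a :: t -> (x == a) = (index x (a :: t) == 0).
  by move=> xat; rewrite -(inj_in_eq (@index_inj _ a (a :: t))) // index_head.
rewrite ia ?mem_next // nb.
have ntt : next t b \in t by rewrite mem_next.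
have ntat : next t b \in a :: t by rewrite inE ntt orbT.
have -> : ((if (index b t).+2 < size (a :: t) then (index b t).+2 else 0) == 0) =
    ~~ ((index b t).+1 < size t) by rewrite /= ltnS; case: ltnP.
case: ifPn => lt; apply: (@index_inj _ a (a :: t)); rewrite ?mem_next // idx // nt.
  rewrite (negPf lt) na ifT //= ltnS; exact: leq_ltn_trans ba'.
by rewrite nb /= ltnS; rewrite negbK in lt; rewrite lt.
Qed.

(** * The bounds of the neighbourhood of a singleton semiblock *)

Section ReceptionBounds.
Variables (T : finType) (Psi : round_rep T) (v : T).
Implicit Types B W U Bl Br : {set T}.
Let V := [set v].
Hypothesis VP : V \in semiblocks Psi.

(** An arrow into [V] shows that [V] is not a left end, so [Bl] is its left far neighbour and [U]
    lies in the range from [Bl] to [V]. *)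
Lemma left_bound_arrow Bl U :
  (if left_end Psi V then near_R Psi V else far_L Psi V) = Some Bl ->
  arrow Psi U V -> Bl != V -> arrow Psi Bl V /\ (U = Bl \/ arrow Psi Bl U).
Proof.
have /semiblocksP[d dl Vd] := VP; rewrite (arrow_inr _ dl Vd) => BlE UV BlV.
have /andP[Ud _] := arrow_blocks UV.
move: BlE; rewrite /left_end (near_LE dl Vd); case: eqP => [/(contig_L_none Vd)[lin V0]|_].
  by have := linear_arrow lin UV; rewrite V0.
rewrite (far_LE dl Vd) => /contig_FlE[Bd BE]; rewrite !(arrow_inl _ dl Bd).
have BlV' : contig_arrow d Bl V by rewrite BE // BlV in_arcl.
split=> //; have [->|UB] := eqVneq U Bl; [by left | right].
suff cy : cyc (index Bl (blocks d)) (index U (blocks d)) (index V (blocks d)).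
  by case/andP: ((contig_round d).2 _ _ _ Bd Ud Vd cy BlV').
move: UV UB BlV; rewrite BE // -!(eq_index (c := d)) // /in_arc /cyc.
by move: (index Bl _) (index U _) (index V _); clear; lia.
Qed.

Lemma right_bound_arrow Br U :
  (if right_end Psi V then near_L Psi V else far_R Psi V) = Some Br ->
  arrow Psi V U -> Br != V -> arrow Psi V Br /\ (U = Br \/ arrow Psi U Br).
Proof.
have /semiblocksP[d dl Vd] := VP; rewrite (arrow_inl _ dl Vd) => BrE VU BrV.
have /andP[_ Ud] := arrow_blocks VU.
move: BrE; rewrite /right_end (near_RE dl Vd); case: eqP => [/(contig_R_none Vd)[lin V0]|_].
  by have := linear_arrow lin VU; have := index_blocks Ud; rewrite -V0 ltnS leqNgt => /negPf->.
rewrite (far_RE dl Vd) => /contig_FrE[Bd BE]; rewrite !(arrow_inl _ dl Vd) (arrow_inl _ dl Ud).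
have VBr : contig_arrow d V Br by rewrite BE // BrV in_arcr.
split=> //; have [->|UB] := eqVneq U Br; [by left | right].
suff cy : cyc (index V (blocks d)) (index U (blocks d)) (index Br (blocks d)).
  by case/andP: ((contig_round d).2 _ _ _ Vd Ud Bd cy VBr).
move: VU UB BrV; rewrite BE // -!(eq_index (c := d)) // /in_arc /cyc.
by move: (index Br _) (index U _) (index V _); clear; lia.
Qed.

(** This excludes circular contigs whose last semiblock has no arrow to the first; the contig axioms
    admit them, and [V] could be its own far neighbour there. *)
Hypothesis near_is_arrow : forall B W, near Psi B W -> arrow Psi B W.
Hypothesis not_isolated : exists W, arrow Psi V W || arrow Psi W V.

(** Alone in a linear contig, [V] would be both of its ends and the bounds would be undefined; an
    arrow at [V] excludes this. *)
Lemma single_contig d : List.In d (contigs Psi) -> V \in blocks d ->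
  ~~ circular d -> index V (blocks d) = 0 -> (index V (blocks d)).+1 = size (blocks d) -> False.
Proof.
move=> dl Vd lin V0; rewrite V0 => sz.
have [W] := not_isolated; rewrite (arrow_inl _ dl Vd) (arrow_inr _ dl Vd).
case/orP=> ar; have /andP[h1 h2] := arrow_blocks ar; have := linear_arrow lin ar; rewrite V0 //.
by have := index_blocks h2; rewrite -sz; case: (index W _).
Qed.

(** At a left end the bound is the right near neighbour, which exists because [V] is not alone.
    Otherwise the left near neighbour has an arrow to [V], so the left far neighbour differs from
    [V]. *)
Lemma left_bound_exists : exists Bl, [/\ Bl \in semiblocks Psi, Bl != V &
  (if left_end Psi V then near_R Psi V else far_L Psi V) = Some Bl].
Proof.
have /semiblocksP[d dl Vd] := VP.
rewrite /left_end (near_LE dl Vd) (near_RE dl Vd) (far_LE dl Vd).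
case: eqP => [/(contig_L_none Vd)[lin V0]|].
  case E : (contig_R d V) => [Bl|]; last first.
    by have [_ /(single_contig dl Vd lin V0)] := (contig_R_none Vd).1 E.
  exists Bl; have [_ Bd H] := (contig_R_some _ _ _).1 E; split=> //.
    by apply/semiblocksP; exists d.
  rewrite -(eq_index Bd Vd) V0; case: H => [->//|[cd]]; by rewrite cd in lin.
case E : (contig_L d V) => [P|] // _; have [X XE] := contig_Fl_some Vd.
exists X; have [Xd XP] := contig_FlE XE; split=> //; first by apply/semiblocksP; exists d.
have PV := contig_L_R E; have [Pd _ _] := (contig_R_some _ _ _).1 PV.
have : arrow Psi P V by apply: near_is_arrow; rewrite /near (near_RE dl Pd) PV.
rewrite (arrow_inr _ dl Vd) XP // -!(eq_index (c := d)) // /in_arc.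
by move: (index X _) (index P _) (index V _); clear; lia.
Qed.

Lemma right_bound_exists : exists Br, [/\ Br \in semiblocks Psi, Br != V &
  (if right_end Psi V then near_L Psi V else far_R Psi V) = Some Br].
Proof.
have /semiblocksP[d dl Vd] := VP.
rewrite /right_end (near_LE dl Vd) (near_RE dl Vd) (far_RE dl Vd).
case: eqP => [/(contig_R_none Vd)[lin V0]|].
  case E : (contig_L d V) => [Br|]; last first.
    by have [_ Vi] := (contig_L_none Vd).1 E; case: (single_contig dl Vd lin Vi V0).
  exists Br; have [Bd _ H] := (contig_R_some _ _ _).1 (contig_L_R E); split=> //.
    by apply/semiblocksP; exists d.
  rewrite -(eq_index Bd Vd); case: H => [->|[cd]]; last by rewrite cd in lin.
  by rewrite neq_ltn ltnSn.
case E : (contig_R d V) => [N|] // _.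
have [X XE] : exists X, contig_Fr d V = Some X by rewrite /contig_Fr Vd; eexists.
exists X; have [Xd XP] := contig_FrE XE; split=> //; first by apply/semiblocksP; exists d.
have [_ Nd _] := (contig_R_some _ _ _).1 E.
have : arrow Psi V N by apply: near_is_arrow; rewrite /near (near_RE dl Vd) E.
rewrite (arrow_inl _ dl Vd) XP // -!(eq_index (c := d)) // /in_arc.
by move: (index X _) (index N _) (index V _); clear; lia.
Qed.

End ReceptionBounds.

(** * Twin classes *)

Section TwinClasses.
Variables (T : finType) (H : sgraph T) (v : T) (pos : T -> nat) (r : rel T).
Hypotheses (pos_inj : injective pos) (vH : v \in vset H).
Hypothesis edgeE : forall x y, edge H x y = r x y || r y x.
Hypothesis round_r : round_on (enum (vset H)) pos r.
Implicit Types (x y z : T) (B W U : {set T}).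
Let V := [set v].

Definition closed_nbh x := x |: nbh H x.

Definition twin x y := (x == y) || [&& x != v, y != v & closed_nbh x == closed_nbh y].

Lemma twin_refl x : twin x x.
Proof. by rewrite /twin eqxx. Qed.

Lemma twin_sym x y : twin x y = twin y x.
Proof. by rewrite /twin eq_sym [closed_nbh x == _]eq_sym andbCA. Qed.

Lemma twin_trans x y z : twin x y -> twin y z -> twin x z.
Proof.
case/orP=> [/eqP->//|/and3P[xv yv /eqP xy]] /orP[/eqP<-|/and3P[_ zv /eqP yz]].
  by rewrite /twin xv yv xy eqxx orbT.
by rewrite /twin xv zv xy yz eqxx orbT.
Qed.

Lemma twin_closed x y : twin x y -> closed_nbh x = closed_nbh y.
Proof. by case/orP=> [/eqP->//|/and3P[_ _ /eqP]]. Qed.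

Definition twin_class x := [set y | twin x y].

Lemma eq_twin_class x y : (twin_class x == twin_class y) = twin x y.
Proof.
apply/eqP/idP => [E|xy]; first by have := twin_refl y; rewrite -[twin y y]in_set -/(twin_class y) -E inE.
apply/setP => z; rewrite !inE; apply/idP/idP; last exact: twin_trans xy.
by apply: twin_trans; rewrite twin_sym.
Qed.

Definition twin_classes := [set twin_class x | x in vset H].
Definition rep B := odflt v [pick x in B].
Definition posB B := pos (rep B).
(** The direction of an arrow between classes may depend on the chosen representatives; adjacency
    does not, since twins have the same closed neighbourhood. *)
Definition rB : rel {set T} := fun B W => r (rep B) (rep W).

Lemma rep_in x : twin x (rep (twin_class x)).
Proof.
by rewrite /rep; case: pickP => [y|/(_ x)]; rewrite inE ?twin_refl.
Qed.

Lemma twin_vset x y : twin x y -> x \in vset H -> y \in vset H.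
Proof.
move=> xy xH; have : y \in closed_nbh x by rewrite (twin_closed xy) !inE eqxx.
by rewrite !inE edge_sym => /orP[/eqP->|/edge_vset].
Qed.

Lemma class_rep B : B \in twin_classes -> B = twin_class (rep B).
Proof.
by case/imsetP=> x _ ->; apply/eqP; rewrite eq_twin_class rep_in.
Qed.

Lemma rep_vset B : B \in twin_classes -> rep B \in vset H.
Proof. by case/imsetP=> x xH ->; apply: twin_vset (rep_in x) xH. Qed.

Lemma class_v : twin_class v = V.
Proof. by apply/setP => x; rewrite !inE /twin eqxx /= orbF eq_sym. Qed.

Lemma V_class : V \in twin_classes.
Proof. by rewrite -class_v imset_f. Qed.

Lemma mem_class B x : B \in twin_classes -> x \in B -> B = twin_class x.
Proof.
by move=> BC; rewrite {1}(class_rep BC) inE => xB; apply/eqP; rewrite {1}(class_rep BC) eq_twin_class.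
Qed.

Lemma posB_inj : {in twin_classes &, injective posB}.
Proof.
by move=> B W BC WC /pos_inj E; rewrite (class_rep BC) (class_rep WC) E.
Qed.

Lemma round_rB (s : seq {set T}) : {subset s <= twin_classes} -> round_on s posB rB.
Proof.
move=> sC; have repE B : B \in s -> rep B \in enum (vset H).
  by move=> /sC/rep_vset; rewrite mem_enum.
split=> [B W Bs Ws|B W U Bs Ws Us]; first by apply: round_r.1; apply: repE.
by apply: round_r.2; apply: repE.
Qed.

Lemma closed_nbhE x y : (y \in closed_nbh x) = (y == x) || edge H y x.
Proof. by rewrite !inE edge_sym. Qed.

Lemma closed_nbh_sym x y : (y \in closed_nbh x) = (x \in closed_nbh y).
Proof. by rewrite !closed_nbhE eq_sym edge_sym. Qed.

Lemma closed_nbh_rep B W : B \in twin_classes -> W \in twin_classes ->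
  (rep W \in closed_nbh (rep B)) = [|| W == B, rB W B | rB B W].
Proof.
move=> BC WC; rewrite closed_nbhE edgeE /rB; congr (_ || _).
by apply/eqP/eqP => [E|->//]; rewrite (class_rep BC) (class_rep WC) E.
Qed.

Lemma twin_class_in x : x \in vset H -> twin_class x \in twin_classes.
Proof. by move=> xH; apply: imset_f. Qed.

(** Closed neighbourhoods are constant on classes, so [x] and [y] can be replaced by their
    representatives one after the other. *)
Lemma edge_class x y : x \in vset H -> y \in vset H ->
  edge H x y = (x != y) && [|| twin_class x == twin_class y,
     rB (twin_class x) (twin_class y) | rB (twin_class y) (twin_class x)].
Proof.
move=> xH yH; have [->|xy] := eqVneq x y; first by rewrite edge_irr.
rewrite /= -closed_nbh_rep ?twin_class_in // -(twin_closed (rep_in y)).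
by rewrite closed_nbh_sym -(twin_closed (rep_in x)) closed_nbhE eq_sym (negPf xy) edge_sym.
Qed.

(** The representatives of [B] and [W] have equal closed neighbourhoods and differ from [v], so they
    are twins. *)
Lemma classes_separated B W : B \in twin_classes -> W \in twin_classes ->
  B != V -> W != V ->
  {in twin_classes, forall U, [|| U == B, rB U B | rB B U] = [|| U == W, rB U W | rB W U]} ->
  B = W.
Proof.
move=> BC WC BV WV same; rewrite (class_rep BC) (class_rep WC); apply/eqP.
have rep_neq_v X : X \in twin_classes -> X != V -> rep X != v.
  by move=> XC; apply: contraNneq => E; rewrite (class_rep XC) E class_v.
rewrite eq_twin_class /twin !rep_neq_v //=; apply/orP; right; apply/eqP/setP => y.
have [yH|yN] := boolP (y \in vset H).
  have in_nbh X : X \in twin_classes -> (y \in closed_nbh (rep X)) =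
      [|| twin_class y == X, rB (twin_class y) X | rB X (twin_class y)].
    move=> XC; rewrite -closed_nbh_rep ?twin_class_in //.
    by rewrite closed_nbh_sym (twin_closed (rep_in y)) closed_nbh_sym.
  by rewrite !in_nbh // same // twin_class_in.
have out X : X \in twin_classes -> (y \in closed_nbh (rep X)) = false.
  move=> XC; apply: contraNF yN; rewrite closed_nbhE.
  by case/orP=> [/eqP->|/edge_vset //]; apply: rep_vset.
by rewrite !out.
Qed.

Lemma class_represents (Phi : round_rep T) (s : seq {set T}) :
  {subset s <= twin_classes} -> semiblocks Phi =i s ->
  (forall B W, arrow Phi B W = [&& B \in s, W \in s & rB B W]) ->
  {in rr_vset Phi &, rr_edge Phi =2 edge H}.
Proof.
move=> sC PhiE arE x y /rr_vsetP[B BP xB] /rr_vsetP[W WP yW].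
have [Bs Ws] : B \in s /\ W \in s by rewrite -!PhiE.
rewrite (rr_edgeE BP WP xB yW) !arE Bs Ws /=.
have mem_vset X z : X \in s -> z \in X -> z \in vset H.
  by move=> /sC XC; rewrite {1}(class_rep XC) inE => /twin_vset; apply; apply: rep_vset.
rewrite (edge_class (mem_vset B x Bs xB) (mem_vset W y Ws yW)).
by rewrite -(mem_class (sC _ Bs) xB) -(mem_class (sC _ Ws) yW).
Qed.

Lemma class_rr_vset (Phi : round_rep T) (s : seq {set T}) : semiblocks Phi =i s ->
  rr_vset Phi = \bigcup_(B <- s) B.
Proof.
move=> PhiE; apply/setP => x; apply/rr_vsetP/mem_bigcup_seq => -[B Bs xB]; exists B => //.
  by rewrite -PhiE.
by rewrite PhiE.
Qed.

Definition class_seq := sort (relpre posB leq) (enum twin_classes).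

Lemma mem_class_seq : class_seq =i twin_classes.
Proof. by move=> B; rewrite mem_sort mem_enum. Qed.

Lemma class_seq_sorted : pos_sorted posB class_seq.
Proof.
have -> : pos_sorted posB class_seq = sorted ltn (map posB class_seq) by rewrite sorted_map.
rewrite ltn_sorted_uniq_leq.
rewrite map_inj_in_uniq ?sort_uniq ?enum_uniq /=; last first.
  by move=> B W; rewrite !mem_class_seq; apply: posB_inj.
by rewrite sorted_map; apply: sort_sorted => B W; apply: leq_total.
Qed.

Lemma class_set0 : set0 \notin class_seq.
Proof.
rewrite mem_class_seq; apply/imsetP => -[x _ /setP/(_ x)].
by rewrite !inE twin_refl.
Qed.

Lemma class_disjoint : pairwise (fun B W : {set T} => [disjoint B & W]) class_seq.
Proof.
apply: pairwise_uniq_in; first exact: pos_sorted_uniq class_seq_sorted.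
move=> B W; rewrite !mem_class_seq => BC WC BW; apply/pred0P => x /=; apply/negP => /andP[xB xW].
by rewrite (mem_class BC xB) (mem_class WC xW) eqxx in BW.
Qed.

Definition rest_seq := [seq B <- class_seq | B != V].

Lemma mem_rest_seq B : (B \in rest_seq) = (B != V) && (B \in twin_classes).
Proof. by rewrite mem_filter mem_class_seq. Qed.

Hypothesis v_not_isolated : nbh H v != set0.

Lemma PCA_receptive : exists Phi, represents Phi (remove_vertex H v) /\ receptive H v Phi.
Proof.
have subC : {subset class_seq <= twin_classes} by move=> B; rewrite mem_class_seq.
have subR : {subset rest_seq <= twin_classes} by move=> B; rewrite mem_rest_seq => /andP[].
have us := pos_sorted_uniq class_seq_sorted.
have rs := round_rB subC; have [asym C2] := rs.
have Vs : V \in class_seq by rewrite mem_class_seq V_class.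
have [Psi [PsiE PsiA PsiN]] := round_rep_of_round class_set0 class_disjoint class_seq_sorted rs.
have [Phi [PhiE PhiA PhiN]] : exists Phi : round_rep T, [/\ semiblocks Phi =i rest_seq,
    forall B W, arrow Phi B W = [&& B \in rest_seq, W \in rest_seq & rB B W] &
    {in rest_seq, forall B, near_R Phi B =
       if rB B (next rest_seq B) then Some (next rest_seq B) else None}].
  apply: (@round_rep_of_round _ _ posB).
  - by rewrite mem_filter negb_and class_set0 orbT.
  - exact: subseq_pairwise (filter_subseq _ _) class_disjoint.
  - exact: pos_sorted_subseq (filter_subseq _ _) class_seq_sorted.
  - exact: round_rB.
have restE B : B \in class_seq -> B != V -> B \in rest_seq by rewrite mem_filter => -> ->.
have irr B : B \in class_seq -> rB B B = false.
  by move=> Bs; apply/negP => rBB; have := asym _ _ Bs Bs rBB; rewrite rBB.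
have PsiH : represents Psi H.
  have PsiV : rr_vset Psi = vset H.
    rewrite (class_rr_vset PsiE); apply/setP => x; apply/mem_bigcup_seq/idP => [[B]|xH].
      rewrite mem_class_seq => BC; rewrite {1}(class_rep BC) inE => /twin_vset.
      by apply; apply: rep_vset.
    by exists (twin_class x); rewrite ?mem_class_seq ?twin_class_in // inE twin_refl.
  split=> // x y /=; have [xP|xN] := boolP (x \in rr_vset Psi); last first.
    transitivity false; last symmetry; apply: contraNF xN; first exact: rr_edge_vset.
    by rewrite PsiV; apply: edge_vset.
  have [yP|yN] := boolP (y \in rr_vset Psi); last first.
    transitivity false; last symmetry; apply: contraNF yN.
      by rewrite rr_edge_sym; apply: rr_edge_vset.
    by rewrite PsiV edge_sym; apply: edge_vset.
  exact: class_represents subC PsiE PsiA _ _ xP yP.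
have PhiH : represents Phi (remove_vertex H v).
  have PhiV : rr_vset Phi = vset H :\ v.
    rewrite (class_rr_vset PhiE); apply/setP => x; rewrite !inE; apply/mem_bigcup_seq/andP => [[B]|[xv xH]].
      rewrite mem_rest_seq => /andP[BV BC] xB; have E := mem_class BC xB.
      split; first by apply: contraNneq BV => xv; rewrite E xv class_v.
      by move: xB; rewrite {1}(class_rep BC) inE => /twin_vset; apply; apply: rep_vset.
    exists (twin_class x); last by rewrite inE twin_refl.
    by rewrite mem_rest_seq twin_class_in // -class_v eq_twin_class /twin (negPf xv) eqxx !andbF.
  split=> // x y /=; rewrite /remove_edge.
  have [xP|xN] := boolP (x \in rr_vset Phi); last first.
    transitivity false; last symmetry; apply: contraNF xN; first exact: rr_edge_vset.
    by rewrite PhiV !inE => /and3P[-> _ /edge_vset].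
  have [yP|yN] := boolP (y \in rr_vset Phi); last first.
    transitivity false; last symmetry; apply: contraNF yN.
      by rewrite rr_edge_sym; apply: rr_edge_vset.
    by rewrite PhiV edge_sym !inE => /and3P[_ -> /edge_vset].
  rewrite (class_represents subR PhiE PhiA xP yP).
  by move: xP yP; rewrite PhiV !inE => /andP[-> _] /andP[-> _].
have del : deletion Psi v Phi.
  split=> [B|B|B W]; first by rewrite PhiE inE PsiE mem_filter.
    rewrite PhiE => BR; have := BR; rewrite mem_filter => /andP[BV Bs].
    rewrite (PhiN _ BR) !PsiN // next_filter // -/V.
    set N := next class_seq V; have Ns : N \in class_seq by rewrite mem_next.
    have [BN|BN] := eqVneq (next class_seq B) V; last first.
      have neSome : (Some (next class_seq B) == Some V) = false.
        by apply: contraNF BN => /eqP[->].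
      by case: (rB B (next class_seq B)); rewrite ?neSome.
    rewrite BN.
    (* An arrow from [B] to [N] passes over [V], so [B -> V -> N], and the near neighbour of [B] in
       [Phi] is then the one that [V] has in [Psi]. Without such an arrow [B] becomes or stays a
       right end. *)
    have through : rB B N -> rB B V && rB V N.
      move=> BrN; apply: (C2 _ _ _ Bs Vs Ns) => //.
      have BneN : index B class_seq != index N class_seq.
        rewrite (inj_in_eq (@index_inj _ set0 _)) //.
        by apply: contraTneq BrN => <-; rewrite irr.
      have Bi : index B class_seq < size class_seq by rewrite index_mem.
      have := index_next us Bs; have := index_next us Vs; rewrite BN -/N.
      rewrite -(pos_cyc class_seq_sorted) // /cyc => NE VE; move: NE VE BneN Bi.
      move: (index B _) (index N _) (index V _) (size _); clear=> b n w k.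
      by case: ifP; case: ifP; lia.
    case BV' : (rB B V); last by rewrite /=; case: ifP => // /through /andP[]; rewrite BV'.
    by rewrite eqxx; case: ifP => [/through/andP[_ ->]|_]; [left | right].
  rewrite !PhiE PhiA PsiA => BR WR; rewrite BR WR.
  by move: BR WR; rewrite !mem_filter => /andP[_ ->] /andP[_ ->].
have VP : V \in semiblocks Psi by rewrite PsiE.
(* This holds at the closing point of a circular contig too, because [Psi] was built with near
   neighbours only where there are arrows. *)
have near_ar A W : near Psi A W -> arrow Psi A W.
  move=> AW; have [c cl /contig_R_some[Ac _ _]] := nearP AW.
  have As : A \in class_seq by rewrite -PsiE; apply/semiblocksP; exists c.
  move: AW; rewrite /near PsiN //; case: ifP => // a /eqP[<-].
  by rewrite PsiA As mem_next As.
have [W0 W0V] : exists W, arrow Psi V W || arrow Psi W V.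
  have /set0Pn[y] := v_not_isolated; rewrite inE => vy.
  have yv : y != v by apply: contraTneq vy => ->; rewrite edge_irr.
  have yP : y \in rr_vset Psi by case: PsiH => /= -> _; rewrite (@edge_vset _ _ y v) // edge_sym.
  have /rr_vsetP[W WP yW] := yP; exists W.
  move: vy; case: PsiH => _ /(_ v y) /= <-; rewrite (rr_edgeE VP WP _ yW) ?inE //.
  have -> // : (V == W) = false; last by case/andP.
  by apply: contraNF yv => /eqP E; move: yW; rewrite -E inE.
have not_iso : exists W, arrow Psi V W || arrow Psi W V by exists W0.
have [Bl [BlP BlV BlE]] := left_bound_exists VP near_ar not_iso.
have [Br [BrP BrV BrE]] := right_bound_exists VP near_ar not_iso.
have rec : reception v Phi Bl Br Psi by split; rewrite ?(mem_deletion del) ?BlV ?BrV.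
exists Phi; split=> //; exists Bl, Br; split; first by exists Psi.
  apply/setP => y; rewrite inE; have [->|yv] := eqVneq y v; last first.
    by rewrite (mem_rr_range_reception rec yv); case: PsiH => _ /(_ v y) /= ->.
  rewrite edge_irr; symmetry; apply/mem_bigcup_seq => -[W].
  rewrite (rr_range_reception del VP _ _ BlE BrE) ?(mem_deletion del) ?BlV ?BrV //.
  case/andP=> /andP[WV WP] _ vW; case/negP: WV; apply/eqP.
  by apply: (semiblock_eq WP VP vW); rewrite inE.
pose adj B := rB B V || rB V B.
have PsiAE A B : A \in class_seq -> B \in class_seq -> arrow Psi A B = rB A B.
  by move=> As Bs; rewrite PsiA As Bs.
have [Bls Brs] : Bl \in class_seq /\ Br \in class_seq by rewrite -!PsiE.
have left_b U : U \in class_seq -> rB U V -> rB Bl V /\ (U = Bl \/ rB Bl U).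
  move=> Us UV; have UV' : arrow Psi U V by rewrite PsiAE.
  by have := left_bound_arrow VP BlE UV' BlV; rewrite !PsiAE.
have right_b U : U \in class_seq -> rB V U -> rB V Br /\ (U = Br \/ rB U Br).
  move=> Us VU; have VU' : arrow Psi V U by rewrite PsiAE.
  by have := right_bound_arrow VP BrE VU' BrV; rewrite !PsiAE.
have restP B : B \in rest_seq -> [/\ B \in class_seq, B \in twin_classes & B != V].
  by rewrite mem_filter mem_class_seq => /andP[-> ->].
have separated B W : B \in rest_seq -> W \in rest_seq -> adj B = adj W ->
    {in rest_seq, forall U, [|| U == B, rB U B | rB B U] = [|| U == W, rB U W | rB W U]} -> B = W.
  move=> /restP[Bs BC BV] /restP[Ws WC WV] adjE same; apply: classes_separated => // U UC.
  have [->|UV] := eqVneq U V; last by apply: same; rewrite restE ?mem_class_seq.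
  by rewrite ![V == _]eq_sym (negPf BV) (negPf WV) /= orbC [RHS]orbC.
have pos_neq A B : A \in class_seq -> B \in class_seq -> A != B -> posB A != posB B.
  move=> As Bs; apply: contraNneq => /posB_inj ->//; by rewrite -mem_class_seq.
have ordered X Y : X \in rest_seq -> Y \in rest_seq -> X != Y ->
    X \notin [:: Bl; Br] -> Y \notin [:: Bl; Br] -> ~ clones rest_seq rB X Y.
  move=> XR YR XY; rewrite !inE !negb_or => /andP[XBl XBr] /andP[YBl YBr] cl.
  have [[Xs XC XV] [Ys YC YV]] := (restP _ XR, restP _ YR).
  have [rXY inXY outXY same] := cl.
  have between W : W \in rest_seq -> cyc (posB X) (posB W) (posB Y) ->
      {in rest_seq, forall U, [|| U == W, rB U W | rB W U] = [|| U == Y, rB U Y | rB Y U]}.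
    move=> WR; apply: (clones_between _ (round_rB subR) XR YR WR cl).
    by move=> A B /restP[_ AC _] /restP[_ BC _]; apply: posB_inj.
  have adjXY : adj X != adj Y by apply: contraNneq XY => E; apply/eqP; apply: separated.
  have pXY := pos_neq _ _ Xs Ys XY; have pXV := pos_neq _ _ Xs Vs XV; have pYV := pos_neq _ _ Ys Vs YV.
  have cXYV : cyc (posB X) (posB Y) (posB V).
    have [cXVY|] := boolP (cyc (posB X) (posB V) (posB Y)).
      have /andP[XaV VaY] := C2 _ _ _ Xs Vs Ys cXVY rXY.
      by move: adjXY; rewrite /adj XaV VaY orbT.
    move: pXY pXV pYV; rewrite /cyc; move: (posB X) (posB Y) (posB V); clear; lia.
  (* An arrow from [V] to [Y] would pass over [X], and one from [X] to [V] over [Y]; either would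
     make both adjacent to [V]. What remains is [V -> X] or [Y -> V]. *)
  have nVY : rB V Y -> False.
    move=> VaY; have c : cyc (posB V) (posB X) (posB Y).
      by move: cXYV; rewrite /cyc; move: (posB X) (posB Y) (posB V); clear; lia.
    have /andP[VaX _] := C2 _ _ _ Vs Xs Ys c VaY.
    by move: adjXY; rewrite /adj VaX VaY !orbT.
  have nXV : rB X V -> False.
    move=> XaV; have /andP[_ YaV] := C2 _ _ _ Xs Ys Vs cXYV XaV.
    by move: adjXY; rewrite /adj XaV YaV.
  have [VaX|nVX] := boolP (rB V X).
    have [VaBr [//|XaBr]] := right_b _ Xs VaX; first by move=> E; rewrite E eqxx in XBr.
    have pXB := pos_neq _ _ Xs Brs XBr; have pYB := pos_neq _ _ Ys Brs YBr.
    have pVB := pos_neq _ _ Brs Vs BrV.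
    (* The three places for [Br]. Between [X] and [Y] it has the neighbours of [Y], hence of [X],
       among the other classes and like [X] is adjacent to [V], so it equals [X]; beyond [Y] it
       would give [V -> Y]; between [V] and [X] it would give [Br -> X] against [X -> Br]. *)
    have : [|| cyc (posB X) (posB Br) (posB Y), cyc (posB V) (posB Y) (posB Br)
             | cyc (posB V) (posB Br) (posB X)].
      move: cXYV pXB pYB pVB; rewrite /cyc.
      by move: (posB X) (posB Y) (posB V) (posB Br); clear; lia.
    case/or3P=> c.
    - have BrR := restE _ Brs BrV; case/eqP: XBr; apply: separated => //.
        by rewrite /adj VaX VaBr !orbT.
      by move=> U UR; rewrite same // between.
    - by have /andP[/nVY] := C2 _ _ _ Vs Ys Brs c VaBr.
    - have /andP[_ BraX] := C2 _ _ _ Vs Brs Xs c VaX.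
      by have := asym _ _ Xs Brs XaBr; rewrite BraX.
  have YaV : rB Y V.
    move: adjXY; rewrite /adj (negPf nVX); have [/nXV//|_] := boolP (rB X V).
    by have [//|_] := boolP (rB Y V); have [/nVY|] := boolP (rB V Y).
  have [BlaV [E|BlaY]] := left_b _ Ys YaV; first by rewrite E eqxx in YBl.
  have pXB := pos_neq _ _ Xs Bls XBl; have pYB := pos_neq _ _ Ys Bls YBl.
  have pVB := pos_neq _ _ Bls Vs BlV.
  (* Likewise [Bl] between [X] and [Y] would equal [Y], between [Y] and [V] it would give [Y -> Bl]
     against [Bl -> Y], and with [X] between [Bl] and [V] it would give [X -> V]. *)
  have : [|| cyc (posB X) (posB Bl) (posB Y), cyc (posB Y) (posB Bl) (posB V)
           | cyc (posB Bl) (posB X) (posB V)].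
    move: cXYV pXB pYB pVB; rewrite /cyc.
    by move: (posB X) (posB Y) (posB V) (posB Bl); clear; lia.
  case/or3P=> c.
  - have BlR := restE _ Bls BlV; case/eqP: YBl; symmetry; apply: separated => //.
      by rewrite /adj YaV BlaV.
    exact: between.
  - have /andP[YaBl _] := C2 _ _ _ Ys Bls Vs c YaV.
    by have := asym _ _ Ys Bls YaBl; rewrite BlaY.
  - by have /andP[_ /nXV] := C2 _ _ _ Bls Xs Vs c BlaV.
move=> X Y XP Xn YP Yn XY /(indistinguishable_clones XP YP XY).
have lift A B : A \in semiblocks Phi -> B \in semiblocks Phi ->
    clones (semiblocks Phi) (arrow Phi) A B -> clones rest_seq rB A B.
  rewrite !PhiE => AR BR [].
  have arE C D : C \in rest_seq -> D \in rest_seq -> arrow Phi C D = rB C D.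
    by move=> CR DR; rewrite PhiA CR DR.
  rewrite arE // => AB H1 H2 H3; split=> // U UR; have := UR; rewrite -PhiE => UP.
  - by have := H1 U UP; rewrite !arE.
  - by have := H2 U UP; rewrite !arE.
  by have := H3 U UP; rewrite !arE.
case=> [/(lift _ _ XP YP)|/(lift _ _ YP XP)]; rewrite !PhiE in XP YP; apply: ordered => //.
by rewrite eq_sym.
Qed.

End TwinClasses.

Unset Implicit Arguments.

Theorem theorem4 (T : finType) (H : sgraph T) (v : T)
    (vH : v \in vset H) (v_not_isolated : nbh H v != set0) :
  (PCA H <->
   exists Phi : round_rep T,
     represents Phi (remove_vertex H v) /\ receptive H v Phi) /\
  (forall (Phi : round_rep T) (Bl Br : {set T}),
     represents Phi (remove_vertex H v) ->
     receptive_by H v Phi Bl Br ->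
     forall Psi : round_rep T, reception v Phi Bl Br Psi -> represents Psi H).
Proof.
have back Phi Bl Br : represents Phi (remove_vertex H v) -> receptive_by H v Phi Bl Br ->
    forall Psi : round_rep T, reception v Phi Bl Br Psi -> represents Psi H.
  by move=> PhiH [_ nH _] Psi; apply: reception_represents.
split=> //; split=> [/PCA_round[pos [r [pos_inj edgeE rr]]]|].
  exact: PCA_receptive pos_inj vH edgeE rr v_not_isolated.
case=> Phi [PhiH [Bl [Br recby]]]; have [[Psi rec] _ _] := recby.
exists T, Psi; have [EV EE] := back Phi Bl Br PhiH recby Psi rec.
by apply: same_graph_isomorphic; split=> // x y.
Qed.
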